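(* Let $K$ be the Vicsek set equipped with its geodesic distance $d$ and normalized Hausdorff measure $\mu$, and let $d_h=\frac{\log5}{\log3}$. For every $p>1$ there exists a constant $C>0$ such that the following Nash inequality holds for every $f\in KS^{\alpha_p,p}(K)$: $$\|f\|_{L^p(K,\mu)}\le C\left(\|f\|_{L^p(K,\mu)}+\mathrm{Var}_p(f)\right)^\theta\|f\|_{L^1(K,\mu)}^{1-\theta},\qquad \theta=\frac{(p-1)d_h}{p-1+pd_h}.$$ For $p=1$, there exists a constant $C>0$ such that for every $f\in KS^{d_h,1}(K)$, $$\|f\|_{L^\infty(K,\mu)}\le C\left(\|f\|_{L^1(K,\mu)}+\mathrm{Var}_1(f)\right).$$
   Context: Vicsek set: let $q_1=(-\tfrac{\sqrt2}2,\tfrac{\sqrt2}2)$, $q_2=(\tfrac{\sqrt2}2,\tfrac{\sqrt2}2)$, $q_3=(\tfrac{\sqrt2}2,-\tfrac{\sqrt2}2)$, $q_4=(-\tfrac{\sqrt2}2,-\tfrac{\sqrt2}2)$, $q_5=(0,0)$, and $\psi_i(z)=\frac13(z-q_i)+q_i$, $1\le i\le5$. $K$ is the unique non-empty compact set with $K=\bigcup_{i=1}^5\psi_i(K)$. Let $\bar V_0\subset K$ be the union of the four segments of length $1$ joining $q_5$ to $q_1,\dots,q_4$ and $\bar V_{n+1}=\bigcup_{i=1}^5\psi_i(\bar V_n)$; $\bigcup_n\bar V_n$ is dense in $K$. The geodesic distance $d$: for $x,y\in\bar V_n$, $d(x,y)$ is the length of the geodesic path in $\bar V_n$ between $x$ and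 $y$, and $d$ is extended by continuity to $K\times K$. $\mu$ is the unique Borel measure on $K$ with $\mu(\psi_{i_1}\circ\cdots\circ\psi_{i_n}(K))=5^{-n}$ for all $i_1,\dots,i_n\in\{1,\dots,5\}$. Let $B(x,r)=\{y\in K:d(x,y)<r\}$. For $p\ge1$, $\alpha\ge0$, $r>0$, $f\in L^p(K,\mu)$ put $$E_{p,\alpha}(f,r)=\int_K\frac{1}{\mu(B(x,r))}\int_{B(x,r)}\frac{|f(y)-f(x)|^p}{r^{p\alpha}}\,d\mu(y)\,d\mu(x).$$ $\mathcal B^{\alpha,p}(K)=\{f\in L^p(K,\mu):\sup_{r>0}E_{p,\alpha}(f,r)<+\infty\}$, $KS^{\alpha,p}(K)=\{f\in L^p(K,\mu):\limsup_{r\to0}E_{p,\alpha}(f,r)<+\infty\}$. ''Constant'' means constant $\mu$-a.e. $\alpha_p=\sup\{\alpha\ge0:\mathcal B^{\alpha,p}(K)\text{ contains non-constant functions}\}$; on the Vicsek set it is known that $\alpha_p=1+\frac{d_h-1}p$ for all $p\ge1$. $\mathrm{Var}_p(f)=\liminf_{r\to0}E_{p,\alpha_p}(f,r)^{1/p}$. *)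

(* Defs.v *)
From HB Require Import structures.
From mathcomp Require Import all_boot all_order all_algebra.
From mathcomp Require Import all_classical all_reals all_analysis.

Set Implicit Arguments.
Unset Strict Implicit.
Unset Printing Implicit Defensive.

Import Order.TTheory GRing.Theory Num.Theory.
Import numFieldNormedType.Exports.

Local Open Scope classical_set_scope.
Local Open Scope ring_scope.

Section Plane.
Variable R : realType.
Implicit Types (x y z : 'rV[R]_2) (gamma : R -> 'rV[R]_2).

Definition plane_pt (a b : R) : 'rV[R]_2 := \row_(j < 2) [:: a; b]`_j.

(* The library norm on 'rV[R]_2 is the sup norm (it induces the same
   topology); lengths below are Euclidean. *)
Definition edist x y : R := Num.sqrt (\sum_(j < 2) (x 0 j - y 0 j) ^+ 2).

Let s : R := Num.sqrt 2 / 2.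

(* q_1, ..., q_5 are indexed from 0 to 4. *)
Definition q (i : 'I_5) : 'rV[R]_2 :=
  [:: plane_pt (- s) s; plane_pt s s; plane_pt s (- s);
      plane_pt (- s) (- s); 0]`_i.

Definition psi (i : 'I_5) (z : 'rV[R]_2) : 'rV[R]_2 :=
  3^-1 *: (z - q i) + q i.

(* psi_word [:: i_1; ...; i_n] = psi i_1 \o ... \o psi i_n *)
Definition psi_word (w : seq 'I_5) : 'rV[R]_2 -> 'rV[R]_2 :=
  foldr (fun i g => psi i \o g) id w.

Definition segment x y : set 'rV[R]_2 :=
  [set (1 - t) *: x + t *: y | t in `[0, 1]].

Fixpoint Vbar (n : nat) : set 'rV[R]_2 :=
  if n is m.+1 then \bigcup_(i : 'I_5) (psi i @` Vbar m)
  else \bigcup_(i in [set i : 'I_5 | i < 4]%N) segment (q ord_max) (q i).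

(* The supremum of the lengths of the inscribed polygonal lines; a partition
   0 < t_1 < ... < t_k = 1 is represented by [:: t_1; ...; t_k]. *)
Definition path_length gamma : \bar R :=
  ereal_sup [set (\sum_(k < size t)
                    edist (gamma (0 :: t)`_k) (gamma t`_k))%:E
            | t in [set t : seq R | itv_partition 0 1 t]].

Definition path_in (A : set 'rV[R]_2) x y gamma : Prop :=
  [/\ {within `[0, 1], continuous gamma}, gamma 0 = x, gamma 1 = y
    & gamma @` `[0, 1] `<=` A].

Definition geodesic_in (A : set 'rV[R]_2) x y gamma : Prop :=
  path_in A x y gamma /\
  forall gamma', path_in A x y gamma' ->
    (path_length gamma <= path_length gamma')%E.

End Plane.

(* The Vicsek set is the unique inhabitant (up to the proof components). *)
Record vicsekSet (R : realType) := VicsekSet {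
  vicsek_carrier :> set 'rV[R]_2 ;
  vicsek_nonempty : vicsek_carrier !=set0 ;
  vicsek_compact : compact vicsek_carrier ;
  vicsek_selfsimilar :
    vicsek_carrier = \bigcup_(i : 'I_5) (psi i @` vicsek_carrier) }.

(* The points of K, with the topology induced by the plane. The base point is
   arbitrary; the library requires one for sigma-algebras. *)
Definition vicsekType (R : realType) (K : vicsekSet R) : Type :=
  set_type (vicsek_carrier K).

Section VicsekType.
Variables (R : realType) (K : vicsekSet R).

Definition vicsek_point : vicsekType K :=
  let x := cid (vicsek_nonempty K) in
  exist (fun z => z \in vicsek_carrier K) (projT1 x) (mem_set (projT2 x)).

HB.instance Definition _ :=
  Topological.copy (vicsekType K) (set_type (vicsek_carrier K)).
HB.instance Definition _ := isPointed.Build (vicsekType K) vicsek_point.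

Definition vval (x : vicsekType K) : 'rV[R]_2 := set_val x.

Definition vicsekBorel := g_sigma_algebraType (@open (vicsekType K)).

End VicsekType.

Definition geodesic_distance (R : realType) (K : vicsekSet R)
    (d : vicsekType K -> vicsekType K -> R) : Prop :=
  continuous (fun z : vicsekType K * vicsekType K => d z.1 z.2) /\
  forall (n : nat) (x y : vicsekType K),
    Vbar n (vval x) -> Vbar n (vval y) ->
    exists2 gamma, geodesic_in (Vbar n) (vval x) (vval y) gamma
                 & path_length gamma = (d x y)%:E.

Definition normalized_measure (R : realType) (K : vicsekSet R)
    (mu : {measure set (vicsekBorel K) -> \bar R}) : Prop :=
  forall w : seq 'I_5,
    mu (@vval R K @^-1` (psi_word w @` vicsek_carrier K))
      = (5 ^- size w)%:E.

Section KorevaarSchoen.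
Context {R : realType} {K : vicsekSet R}.
Variable d : vicsekType K -> vicsekType K -> R.
Variable mu : {measure set (vicsekBorel K) -> \bar R}.
Implicit Types (p alpha r : R) (f : vicsekBorel K -> R).

Definition dball (x : vicsekType K) r : set (vicsekBorel K) :=
  [set y | d x y < r].

Definition energy p alpha f r : \bar R :=
  (\int[mu]_x ((mu (dball x r))^-1 *
     \int[mu]_(y in dball x r)
        (`|f y - f x| `^ p / r `^ (p * alpha))%:E))%E.

Definition besov alpha p : set (vicsekBorel K -> R) :=
  [set f | f \in Lfun mu p%:E /\
           (ereal_sup [set energy p alpha f r | r in [set r | 0 < r]%R]
              < +oo)%E].

Definition KS alpha p : set (vicsekBorel K -> R) :=
  [set f | f \in Lfun mu p%:E /\
           (limf_esup (energy p alpha f) 0%R^'+ < +oo)%E].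

Definition ae_constant f : Prop :=
  exists c : R, {ae mu, forall x, f x = c}.

(* For p >= 1 this set of exponents contains 0 and is bounded above, so the
   default value of sup plays no role. *)
Definition critical_exponent p : R :=
  sup [set alpha | 0 <= alpha /\
                   exists2 f, besov alpha p f & ~ ae_constant f].

Definition Var p f : \bar R :=
  limf_einf (fun r => energy p (critical_exponent p) f r `^ p^-1)%E 0^'+.

End KorevaarSchoen.

Definition hausdorff_dim (R : realType) : R := ln 5 / ln 3.

(* Main.v *)
Require Import Defs.
From HB Require Import structures.
From mathcomp Require Import all_boot all_order all_algebra.
From mathcomp Require Import all_classical all_reals all_analysis.
From mathcomp Require Import measurable_realfun ess_sup_inf.
From mathcomp Require Import zify ring lra.

Set Implicit Arguments.
Unset Strict Implicit.
Unset Printing Implicit Defensive.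

Import Order.TTheory GRing.Theory Num.Theory.
Import numFieldNormedType.Exports.

Local Open Scope classical_set_scope.
Local Open Scope ring_scope.

(** Everything rests on the tree-like structure of the Vicsek set. Cells of level
    [n] are the images of the set under the words of size [n]; they have diameter
    about 3 ^- n and mass 5 ^- n, so that balls of radius about 3 ^- n are
    comparable to cells of level [n] (lemmas [distance_ge], [distance_le] and
    [mu_dball_le]; the constants are obtained with the sup norm of the plane).
    The energy at such a radius therefore dominates the oscillation of the
    function on pairs of adjacent cells ([energy_ge_oscillation]).

    Inside a cell of level [k], every cell of level [k + m] is joined to those at
    the corners by self-avoiding chains of at most 3 ^ m adjacent cells
    ([chain_corner]), because a geodesic to a corner crosses at most three
    subcells of each cell. Summing the
    differences of averages along this chain with Holder's inequality gives a
    Poincare inequality on cells with constant 5 ^ m * (3 ^ m) ^ (p - 1)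
    ([poincare_cell]). At the exponent alpha = 1 + (d_h - 1) / p this factor is
    exactly compensated by the powers of the radius in the energy, so that the
    oscillation on the cells of level [k] is bounded by the energy at every
    smaller radius ([poincare]); the lower limit of the energies is thus enough.

    This exponent is the critical one ([critical_exponentE]). At a larger
    exponent the same inequality makes every function of bounded energy constant
    ([besov_constant]). At this exponent the projection of the set on a diagonal
    of the square has finite energies: it is Lipschitz, and it is locally
    constant off the diagonal, where the set branches ([diagonal_map_besov]).

    For p > 1, the integral of |f| ^ p is at most the oscillation on the cells of
    level [k], paid by the variation with a factor (3 ^- k) ^ (p * alpha), plus
    the contribution of the averages, paid by the L^1 norm with a factor
    (5 ^ k) ^ (p - 1) ([nash_at_scale]). Choosing [k] so that the two terms have
    the same order ([balance_scales]) gives the Nash inequality. For p = 1 the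
    length of chains costs nothing, so all averages over cells of all levels are
    bounded by the L^1 norm plus a multiple of the variation
    ([averages_bounded]), and so is the function itself. *)

(** * Power inequalities and self-avoiding chains of words *)

Section PowerSums.
Variable R : realType.
Implicit Types p a b S T x y : R.

(** Weighted convexity of the power function. Read the hypotheses as bounds
    across two consecutive stretches of a chain, of lengths [a] and [b] and of
    discrete energies [S] and [T]; then lengths and energies both add up. *)
Lemma power_chain p a b S T x y : 1 <= p -> 0 < a -> 0 < b ->
  `|x| `^ p <= a `^ (p - 1) * S -> `|y| `^ p <= b `^ (p - 1) * T ->
  `|x + y| `^ p <= (a + b) `^ (p - 1) * (S + T).
Proof.
move=> p1 a0 b0 hx hy.
have p0 : 0 <= p by lra.
have ab0 : 0 < a + b by lra.
have pm (c : R) : 0 < c -> c `^ p = c * c `^ (p - 1).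
  move=> c0; rewrite -[X in X * _](powRr1 (ltW c0)) -powRD.
    by rewrite [1 + _]addrC subrK.
  by apply/implyP => _; rewrite gt_eqF.
have scale (c z W : R) : 0 < c -> `|z| `^ p <= c `^ (p - 1) * W ->
    (`|z| / c) `^ p <= W / c.
  move=> c0 hz.
  have cV : c^-1 `^ p = (c * c `^ (p - 1))^-1.
    by rewrite -(powR_inv1 (ltW c0)) -powRrM mulN1r powRN pm.
  rewrite powRM ?invr_ge0 ?(ltW c0)// cV.
  have cp : 0 < c `^ (p - 1) by rewrite powR_gt0.
  by rewrite ler_pdivrMr ?mulr_gt0// (_ : _ / _ * _ = c `^ (p - 1) * W)//; field; rewrite !gt_eqF.
have t01 : 0 <= a / (a + b) <= 1.
  apply/andP; split; first by rewrite divr_ge0// ltW.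
  by rewrite ler_pdivrMr// mul1r; lra.
have := @convex_powR R p p1 (Itv01 (proj1 (andP t01)) (proj2 (andP t01)))
  (`|x| / a) (`|y| / b).
rewrite !inE/= !in_itv/= !andbT !divr_ge0 ?(ltW a0) ?(ltW b0)// => /(_ isT isT) cv.
rewrite [X in X `^ _ <= _]convRE [X in _ <= X]convRE /= /unstable.onem in cv.
move: cv; have -> : a / (a + b) * (`|x| / a) + (1 - a / (a + b)) * (`|y| / b) =
  (`|x| + `|y|) / (a + b) by field; rewrite !gt_eqF.
have -> : 1 - a / (a + b) = b / (a + b) by field; rewrite gt_eqF.
move=> cv.
have {}cv : ((`|x| + `|y|) / (a + b)) `^ p <= (S + T) / (a + b).
  apply: (le_trans cv).
  rewrite (_ : (S + T) / (a + b) = a / (a + b) * (S / a) + b / (a + b) * (T / b)).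
    by apply: lerD; apply: ler_wpM2l; rewrite ?scale// divr_ge0// ltW.
  by field; rewrite !gt_eqF.
rewrite (le_trans (ge0_ler_powR p0 _ _ (ler_normD x y)))// ?nnegrE ?addr_ge0 ?normr_ge0//.
have -> : (`|x| + `|y|) `^ p = (a + b) `^ p * ((`|x| + `|y|) / (a + b)) `^ p.
  rewrite -powRM ?divr_ge0 ?(ltW ab0) ?addr_ge0//.
  by congr (_ `^ _); field; rewrite gt_eqF.
apply: (le_trans (ler_wpM2l (powR_ge0 _ _) cv)).
rewrite (pm _ ab0).
rewrite (_ : (a + b) * (a + b) `^ (p - 1) * _ = (a + b) `^ (p - 1) * (S + T))//.
by field; rewrite gt_eqF.
Qed.

(** The case of two stretches of equal length. *)
Lemma powR_normD p x y : 1 <= p ->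
  `|x + y| `^ p <= 2 `^ p * (`|x| `^ p + `|y| `^ p).
Proof.
move=> p1; have := @power_chain p 1 1 (`|x| `^ p) (`|y| `^ p) x y p1 ltr01 ltr01.
rewrite powR1 !mul1r => /(_ (lexx _) (lexx _)) h; apply: (le_trans h).
rewrite ler_wpM2r ?addr_ge0 ?powR_ge0// (_ : 1 + 1 = 2)//.
by rewrite ler_powR; lra.
Qed.

End PowerSums.

Notation word := (seq 'I_5).

(** Meaningful for the four corners, which are numbered around the square. *)
Definition opposite (i : 'I_5) : 'I_5 := inord ((i + 2) %% 4).

Lemma opposite_lt4 i : (opposite i < 4)%N.
Proof. by rewrite inordK ?ltn_pmod// (ltn_trans (ltn_pmod _ _)). Qed.

Lemma lt4_center (i : 'I_5) : (i < 4)%N = (i != ord_max).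
Proof. by rewrite -val_eqE /= ltn_neqAle -ltnS ltn_ord andbT. Qed.

Section Chains.
Variable adj : rel word.

(** Walks are required to be self-avoiding so that the energy collected along
    a walk is at most the energy of the region [P] it stays in. *)
Definition chain (P : pred word) (w e : word) (n : nat) :=
  exists s, [/\ path adj w s, last w s = e, uniq (w :: s), all P (w :: s)
    & (size s < n)%N].

Lemma chain_sub (P Q : pred word) w e n :
  {subset P <= Q} -> chain P w e n -> chain Q w e n.
Proof.
by move=> PQ [s [? ? ? /allP sP ?]]; exists s; split => //; apply/allP => v /sP /PQ.
Qed.

Lemma chain_le (P : pred word) w e n n' :
  (n <= n')%N -> chain P w e n -> chain P w e n'.
Proof. by move=> nn' [s [? ? ? ? ?]]; exists s; split => //; exact: leq_trans nn'. Qed.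

Lemma chain_cat (P Q : pred word) w e w' e' n n' :
  (forall v, P v -> ~~ Q v) -> adj e w' -> chain P w e n -> chain Q w' e' n' ->
  chain [predU P & Q] w e' (n + n').
Proof.
move=> PQ ew' [s [ps ls us /allP Ps ns]] [t [pt lt ut /allP Qt nt]].
exists (s ++ w' :: t); split.
- by rewrite cat_path ps /= ls ew' pt.
- by rewrite last_cat /= lt.
- rewrite -cat_cons cat_uniq us ut andbT; apply/hasPn => v /Qt Qv.
  by apply/negP => /Ps /PQ; rewrite Qv.
- apply/allP => v; rewrite -cat_cons mem_cat => /orP[/Ps Pv|/Qt Qv].
    by rewrite inE/= [v \in P]Pv.
  by rewrite inE/= orbC [v \in Q]Qv.
- by rewrite size_cat /=; lia.
Qed.

Hypothesis adj_cons : forall i w w', adj w w' -> adj (i :: w) (i :: w').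
Hypothesis adj_out : forall (i : 'I_5) m, (i < 4)%N ->
  adj (ord_max :: nseq m i) (i :: nseq m (opposite i)).
Hypothesis adj_in : forall (i : 'I_5) m, (i < 4)%N ->
  adj (i :: nseq m (opposite i)) (ord_max :: nseq m i).

Lemma chain_cons (P : pred word) i w e n : chain P w e n ->
  chain (fun v => if v is k :: v' then (k == i) && P v' else false)
    (i :: w) (i :: e) n.
Proof.
move=> [s [ps ls us Ps ns]]; exists (map (cons i) s); split.
- by elim: s w ps {ls us Ps ns} => //= v s IH w /andP[/adj_cons-> /IH].
- by rewrite last_map ls.
- by rewrite -map_cons map_inj_uniq// => x y [].
- by rewrite -map_cons all_map; apply: sub_all Ps => v /= ->; rewrite eqxx.
- by rewrite size_map.
Qed.

Let sized (m : nat) : pred word := fun v => size v == m.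
Let child (i : 'I_5) (m : nat) : pred word :=
  fun v => if v is k :: v' then (k == i) && (size v' == m) else false.

Let child_sized i m : {subset child i m <= sized m.+1}.
Proof. by move=> [|k v]//= /andP[_]. Qed.

Let child_disj i j m v : i != j -> child i m v -> ~~ child j m v.
Proof.
by case: v => //= k v ij /andP[/eqP-> _]; rewrite (negbTE ij).
Qed.

(** A walk from a cell to a corner cell crosses each of the at most three
    subcells on its way once, from corner to corner; since 3 * 3 ^ m is
    3 ^ (m + 1), this is the recursion behind the geodesic diameter. *)
Lemma chain_corner m (w : word) (j : 'I_5) : size w = m -> (j < 4)%N ->
  chain (sized m) w (nseq m j) (3 ^ m).
Proof.
elim: m w j => [|m IH] [|i w]// j; first by exists [::]; split.
case=> sw j4.
have step (k : 'I_5) v (l : 'I_5) : size v = m -> (l < 4)%N ->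
    chain (child k m) (k :: v) (k :: nseq m l) (3 ^ m).
  by move=> sv l4; exact/chain_cons/IH.
have sn k : size (nseq m k) = m :> nat by rewrite size_nseq.
have [ij|ij] := eqVneq i j.
  rewrite ij; apply: chain_le (chain_sub _ (step j w j sw j4)).
    by rewrite leq_pexp2l.
  exact: child_sized.
have [ic|ic] := eqVneq i ord_max.
  (* from the central subcell: two subcells on the way *)
  have h := chain_cat (fun v => child_disj (v := v) ij) (P := child i m)
    (Q := child j m).
  rewrite ic in h *.
  have h' := h _ _ _ _ _ _ (adj_out m j4) (step _ w j sw j4)
    (step j _ j (sn _ (opposite j)) j4).
  apply: chain_le (chain_sub _ h'); first by rewrite expnS; lia.
  by move=> v /orP[] /child_sized.
have i4 : (i < 4)%N by rewrite lt4_center.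
have oi4 := opposite_lt4 i.
(* from the subcell [i] through the central one to the subcell [j] *)
have cj : ord_max != j by rewrite eq_sym -lt4_center.
have h1 := chain_cat (fun v => child_disj (v := v) cj) (adj_out m j4)
  (step ord_max _ j (sn _ i) j4) (step j _ j (sn _ (opposite j)) j4).
have dis v : child i m v -> ~~ [predU child ord_max m & child j m] v.
  move=> hv; apply/negP => /orP[]; apply/negP.
    exact: child_disj ic hv.
  exact: child_disj ij hv.
have h2 := chain_cat dis (adj_in m i4) (step i w _ sw oi4) h1.
apply: chain_le (chain_sub _ h2).
  by rewrite expnS; lia.
by move=> v /orP[|/orP[]] /child_sized.
Qed.

(** The energy of the walk is dominated by the energy of the whole cell
    because the walk visits no word twice. *)
Lemma chain_estimate (R : realType) (p : R) (a sg : word -> R) (u : word) m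
    (w : word) (j : 'I_5) :
  1 <= p -> (forall v, 0 <= sg v) ->
  (forall v v', adj v v' -> size v = m -> size v' = m ->
     `|a (u ++ v') - a (u ++ v)| `^ p <= sg (u ++ v)) ->
  size w = m -> (j < 4)%N ->
  `|a (u ++ nseq m j) - a (u ++ w)| `^ p <=
    (3 ^+ m) `^ (p - 1) * \sum_(t : m.-tuple 'I_5) sg (u ++ t).
Proof.
move=> p1 sg0 hadj sw j4.
have [s [ps ls us Ps ns]] := chain_corner sw j4.
have walk : forall x t, path adj x t -> all (sized m) (x :: t) ->
    `|a (u ++ last x t) - a (u ++ x)| `^ p <=
    (size (x :: t))%:R `^ (p - 1) * \sum_(v <- x :: t) sg (u ++ v).
  move=> x t; elim: t x => [|y t IHt] x /=.
    by move=> _ _; rewrite subrr normr0 powR0 ?mulr_ge0 ?powR_ge0 ?sumr_ge0// gt_eqF//; lra.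
  move=> /andP[xy pt] /andP[sx /andP[sy st]].
  rewrite big_cons -(subrK (a (u ++ y)) (a (u ++ last y t))) -addrA.
  rewrite -natr1 addrC addrC (addrC (sg _)).
  apply: power_chain => //.
    by apply: IHt => //=; rewrite sy.
  by rewrite powR1 mul1r; apply: hadj xy (eqP sx) (eqP sy).
have := walk w s ps Ps; rewrite ls => h; apply: (le_trans h).
apply: ler_pM.
- by rewrite powR_ge0.
- by rewrite sumr_ge0.
- rewrite ge0_ler_powR ?nnegrE ?exprn_ge0//; first lra.
  by rewrite -natrX ler_nat.
- (* the walk is part of a duplicate-free enumeration of the words of size m *)
  have -> : \sum_(t : m.-tuple 'I_5) sg (u ++ t) =
      \sum_(v <- [seq val t | t <- enum {: m.-tuple 'I_5}]) sg (u ++ v).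
    by rewrite big_map big_enum.
  set L := map _ _.
  have LP : perm_eq L ((w :: s) ++ [seq v <- L | v \notin w :: s]).
    have uL : uniq L by rewrite map_inj_uniq ?enum_uniq//; exact: val_inj.
    apply: uniq_perm => //.
      rewrite cat_uniq us filter_uniq// andbT; apply/hasPn => v.
      by rewrite mem_filter => /andP[].
    move=> v; rewrite mem_cat mem_filter; case: (boolP (v \in w :: s)) => //= vs.
    apply/mapP; move/allP : Ps => /(_ v vs)/eqP sv.
    by exists (tcast sv (in_tuple v)); rewrite ?mem_enum//= val_tcast.
  by rewrite (perm_big _ LP) big_cat /= lerDl sumr_ge0.
Qed.

End Chains.

(** * Geometry of the contractions *)

Section PlaneGeometry.
Variable R : realType.
Implicit Types (x y z : 'rV[R]_2) (w : word) (i j : 'I_5).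

Lemma rV2_norm_le x (r : R) : 0 <= r -> (forall k, `|x 0 k| <= r) -> `|x| <= r.
Proof.
move=> r0 h; change (mx_norm x <= r).
have [->//|/mx_norm_neq0[[i k] /= ->]] := eqVneq (mx_norm x) 0.
by rewrite (ord1 i).
Qed.

Lemma coord_le_norm x k : `|x 0 k| <= `|x|.
Proof.
rewrite [leRHS]mx_normrE.
exact: (le_bigmax _ (fun ij : 'I_1 * 'I_2 => `|x ij.1 ij.2|) (0, k)).
Qed.

(** The sup norm of the four corners. *)
Definition half_side : R := Num.sqrt 2 / 2.

Lemma half_side_gt0 : 0 < half_side.
Proof. by rewrite divr_gt0// sqrtr_gt0. Qed.

Lemma half_side_sq : half_side ^+ 2 = 2^-1.
Proof. by rewrite /half_side expr_div_n sqr_sqrtr//; field. Qed.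

Lemma half_side_lt1 : half_side < 1.
Proof. by have := half_side_sq; have := half_side_gt0; nra. Qed.

Lemma half_side_gt : 2^-1 < half_side.
Proof. by have := half_side_sq; have := half_side_gt0; nra. Qed.

(** The corners are, up to the factor [half_side], points with coordinates in
    -1, 0, 1; this makes the centres of cells points of a grid. *)
Definition digit (k : 'I_2) (i : 'I_5) : int :=
  if k == 0 then [:: -1; 1; 1; -1; 0]`_i else [:: 1; 1; -1; -1; 0]`_i.

Lemma digit_cases k i : [\/ digit k i = -1, digit k i = 0 | digit k i = 1].
Proof.
rewrite /digit; case: ifP => _; case: i => -[|[|[|[|[|]]]]]//= _;
 by [constructor 1|constructor 2|constructor 3].
Qed.

Lemma digit_inj i j : (forall k, digit k i = digit k j) -> i = j.
Proof.
move=> h; move: (h 0) (h 1); rewrite /digit /=.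
by case: i {h} => -[|[|[|[|[|]]]]]//= ?; case: j => -[|[|[|[|[|]]]]]//= ? _ _;
  exact: val_inj.
Qed.

Lemma q_coord i (k : 'I_2) : q R i 0 k = half_side * (digit k i)%:~R.
Proof.
rewrite /q /digit /plane_pt -/half_side.
by case: i => -[|[|[|[|[|]]]]]//= ?; case: k => -[|[|]]//= ?;
  rewrite !mxE /=; ring.
Qed.

Lemma q_center : q R ord_max = 0.
Proof. by []. Qed.

Lemma q_opposite i : (i < 4)%N -> q R (opposite i) = - q R i.
Proof.
move=> i4; apply/rowP => k; rewrite mxE !q_coord -mulrN; congr (_ * _).
rewrite -mulrNz; congr (_%:~R); rewrite /digit inordK ?(ltn_trans (ltn_pmod _ _))//.
by case: ifP => _; case: i i4 => -[|[|[|[|[|]]]]].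
Qed.

Lemma norm_q i : `|q R i| <= half_side.
Proof.
have h0 := half_side_gt0.
apply: rV2_norm_le (ltW h0) _ => k; rewrite q_coord normrM (gtr0_norm h0).
by rewrite ler_piMr ?(ltW h0)//; case: (digit_cases k i) => ->; rewrite ?normrN ?normr1 ?normr0.
Qed.

Lemma psi_q i : psi i (q R i) = q R i.
Proof. by rewrite /psi subrr scaler0 add0r. Qed.

Lemma psi_center z : psi ord_max z = 3^-1 *: z.
Proof. by rewrite /psi q_center subr0 addr0. Qed.

Lemma psi_opposite i : (i < 4)%N ->
  psi i (q R (opposite i)) = psi ord_max (q R i).
Proof.
move=> i4; rewrite psi_center /psi q_opposite//.
by apply/rowP => k; rewrite !mxE; field.
Qed.

Lemma psi_coord i z k :
  psi i z 0 k = 3^-1 * z 0 k + 3^-1 * (2 * half_side) * (digit k i)%:~R.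
Proof. by rewrite /psi !mxE q_coord; field. Qed.

Lemma psi_sub i x y : psi i x - psi i y = 3^-1 *: (x - y).
Proof. by apply/rowP => k; rewrite !mxE; field. Qed.

Lemma psi_word_cat (u v : word) z :
  psi_word (u ++ v) z = psi_word u (psi_word v z).
Proof. by elim: u => //= i u ->. Qed.

Lemma psi_word_sub w x y : psi_word w x - psi_word w y = 3 ^- size w *: (x - y).
Proof.
elim: w => [|i w IH] /=; first by rewrite expr0 invr1 scale1r.
by rewrite psi_sub IH scalerA -invfM -exprS.
Qed.

Lemma psi_word_dist w x y :
  `|psi_word w x - psi_word w y| = 3 ^- size w * `|x - y|.
Proof. by rewrite psi_word_sub normrZ ger0_norm// invr_ge0 exprn_ge0. Qed.

Lemma psi_word_corner m i : psi_word (nseq m i) (q R i) = q R i.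
Proof. by elim: m => //= m ->; rewrite psi_q. Qed.

(** A common corner, rather than any common point, is asked for because chains
    of cells and paths pass from a cell to the next one through a corner. *)
Definition adjacent (w w' : word) : Prop :=
  exists i j, [/\ (i < 4)%N, (j < 4)%N & psi_word w (q R i) = psi_word w' (q R j)].

Lemma adjacent_refl w : adjacent w w.
Proof. by exists 0, 0. Qed.

Lemma adjacent_sym w w' : adjacent w w' -> adjacent w' w.
Proof. by move=> [i [j [i4 j4 e]]]; exists j, i. Qed.

Lemma adjacent_cat u w w' : adjacent w w' -> adjacent (u ++ w) (u ++ w').
Proof. by move=> [i [j [i4 j4 e]]]; exists i, j; rewrite !psi_word_cat e. Qed.

Lemma adjacent_center i m : (i < 4)%N ->
  adjacent (ord_max :: nseq m i) (i :: nseq m (opposite i)).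
Proof.
move=> i4; exists i, (opposite i); split => //; first exact: opposite_lt4.
by rewrite /= !psi_word_corner psi_opposite.
Qed.

End PlaneGeometry.

Arguments half_side {R}.

(** Writing cell centres in base 3 with the digits -1, 0 and 1. *)
Section BalancedTernary.
Variable e : 'I_5 -> int.
Hypothesis e1 : forall i, `|e i| <= 1.

Fixpoint ternary (w : word) : int :=
  if w is i :: w' then 3 ^+ size w' * e i + ternary w' else 0.

Lemma ternary_small w : 2 * `|ternary w| < 3 ^+ size w.
Proof.
elim: w => [|i w IH] /=; first by rewrite normr0 mulr0.
have t0 : (0 : int) < 3 ^+ size w by rewrite exprn_gt0.
have := e1 i; rewrite exprS; set t := 3 ^+ size w in t0 IH *.
move: IH; set a := ternary w; set b := e i => ha hb.
have : `|t * b| <= t by rewrite normrM gtr0_norm// ler_piMr// ltW.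
by have := ler_normD (t * b) a; lra.
Qed.

(** The leading digit is determined because the tail is less than half of the
    leading power of 3. *)
Lemma ternary_inj w w' : size w = size w' -> ternary w = ternary w' ->
  map e w = map e w'.
Proof.
elim: w w' => [|i w IH] [|i' w'] //= [sw] E.
have := ternary_small w; have := ternary_small w'.
have t0 : (0 : int) < 3 ^+ size w by rewrite exprn_gt0.
rewrite -sw in E *; set t := 3 ^+ size w in t0 E * => h' h.
have ee : e i = e i'.
  have {}E : t * (e i - e i') = ternary w' - ternary w by rewrite mulrBr; lia.
  apply/eqP; rewrite -subr_eq0; apply/negPn/negP => n0.
  have : t <= `|t * (e i - e i')|.
    have n1 : 1 <= `|e i - e i'| by move: n0; clear; lia.
    by rewrite normrM gtr0_norm// ler_peMr// ltW.
  by rewrite E; lia.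
by rewrite ee (IH w')//; move: E; rewrite ee => /addrI.
Qed.

End BalancedTernary.

Section Centres.
Variable R : realType.
Implicit Types (w : word).

Lemma digit_le1 k i : `|digit k i| <= 1.
Proof. by case: (digit_cases k i) => ->. Qed.

Lemma psi_word0_coord w k : psi_word w (0 : 'rV[R]_2) 0 k =
  3 ^- size w * (2 * half_side) * (ternary (digit k) w)%:~R.
Proof.
elim: w => [|i w IH] /=; first by rewrite mxE mulr0.
rewrite psi_coord IH intrD intrM rmorphXn /= exprS.
by field; rewrite expf_neq0.
Qed.

(** Centres of distinct cells of the same level are distinct points of a grid
    of mesh comparable to the size of these cells. *)
Lemma centre_coord_dist w w' k (rho : R) : size w' = size w ->
  `|psi_word w (0 : 'rV[R]_2) - psi_word w' 0| <= rho * 3 ^- size w ->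
  `|ternary (digit k) w - ternary (digit k) w'|%:~R <= rho.
Proof.
move=> sw h; have := le_trans (coord_le_norm _ k) h.
rewrite !mxE !psi_word0_coord sw -mulrBr -intrB normrM.
have n0 : (0 : R) < 3 ^- size w by rewrite invr_gt0 exprn_gt0.
have h0 := half_side_gt R.
rewrite gtr0_norm; last by rewrite mulr_gt0//; lra.
rewrite -mulrA [leRHS]mulrC ler_pM2l// => {}h.
by rewrite intr_norm; apply: le_trans h; rewrite ler_peMl//; lra.
Qed.

End Centres.

(** * Cells of the Vicsek set *)

Section VicsekSet.
Variables (R : realType) (K : vicsekSet R).
Implicit Types (x y z : 'rV[R]_2) (w : word) (i j : 'I_5).

Definition cell (w : word) : set 'rV[R]_2 :=
  psi_word w @` vicsek_carrier K.

Lemma psi_carrier i x : vicsek_carrier K x -> vicsek_carrier K (psi i x).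
Proof. by move=> Kx; rewrite (vicsek_selfsimilar K); exists i => //; exists x. Qed.

Lemma psi_word_carrier w x : vicsek_carrier K x -> vicsek_carrier K (psi_word w x).
Proof. by move=> Kx; elim: w => //= i w IH; exact: psi_carrier. Qed.

Lemma carrier_address n x : vicsek_carrier K x -> exists2 w, size w = n & cell w x.
Proof.
elim: n x => [|n IH] x Kx; first by exists [::] => //; exists x.
move: Kx; rewrite {1}(vicsek_selfsimilar K) => -[i _ [y Ky <-]].
have [w sw [z Kz <-]] := IH y Ky.
by exists (i :: w); [rewrite /= sw|exists z].
Qed.

Lemma cell_nil : cell [::] = vicsek_carrier K.
Proof. by apply/seteqP; split => [x [y Ky <-]//|x Kx]; exists x. Qed.

Lemma cell_sub w : cell w `<=` vicsek_carrier K.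
Proof. by move=> _ [x Kx <-]; exact: psi_word_carrier. Qed.

Lemma cell_split u n x : cell u x -> exists2 w, size w = n & cell (u ++ w) x.
Proof.
move=> [y Ky <-]; have [w sw [z Kz <-]] := carrier_address n Ky.
by exists w => //; exists z => //; rewrite psi_word_cat.
Qed.

Lemma geometric_small (B e : R) : 0 < e -> exists n, B * 3 ^- n < e.
Proof.
move=> e0; have [B0|B0] := leP B 0.
  by exists 0%N; rewrite expr0 invr1 mulr1 (le_lt_trans B0).
have [n h] : exists n, (B / e) < n%:R :> R.
  by exists (Num.bound (B / e)); apply/archi_boundP/divr_ge0; exact: ltW.
exists n; rewrite ltr_pdivrMr ?exprn_gt0// mulrC -ltr_pdivrMr//.
by rewrite (lt_trans h)// -natrX ltr_nat ltn_expl.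
Qed.

Lemma carrier_closed : closed (vicsek_carrier K).
Proof. exact: compact_closed (@vicsek_compact _ K). Qed.

(** The corner [q i] is the limit of the images of any point of the set under
    the iterates of the contraction that fixes it. *)
Lemma carrier_q i : vicsek_carrier K (q R i).
Proof.
apply: carrier_closed => A /nbhs_ballP[e /= e0 eA].
have [x Kx] := vicsek_nonempty K.
have [n h] := geometric_small `|q R i - x| e0.
exists (psi_word (nseq n i) x); split; first exact: psi_word_carrier.
apply: eA; rewrite -ball_normE /= -(psi_word_corner R n i) psi_word_dist size_nseq.
by rewrite mulrC.
Qed.

Lemma carrier0 : vicsek_carrier K 0.
Proof. exact: (carrier_q ord_max). Qed.

(** Each application of the maps divides by 3 the excess over the square with
    the four corners, which the maps preserve. *)
Lemma carrier_norm x : vicsek_carrier K x -> `|x| <= half_side.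
Proof.
move=> Kx.
have [M hM] : exists M : R, forall y, vicsek_carrier K y -> `|y| <= M.
  have [M [_ hM]] := compact_bounded (@vicsek_compact _ K).
  by exists (M + 1) => y Ky; apply: (hM (M + 1)) => //; rewrite ltrDl.
have bound n y : vicsek_carrier K y -> `|y| <= half_side + M * 3 ^- n.
  elim: n y => [|n IH] y Ky.
    by rewrite expr0 invr1 mulr1 (le_trans (hM _ Ky))// lerDr ltW// half_side_gt0.
  move: Ky; rewrite {1}(vicsek_selfsimilar K) => -[i _ [z Kz <-]].
  have -> : psi i z = 3^-1 *: z + (2 / 3) *: q R i.
    by apply/rowP => k; rewrite !mxE; field.
  apply: (le_trans (ler_normD _ _)); rewrite !normrZ !ger0_norm//.
  have := IH z Kz; have := norm_q R i; rewrite exprS invfM mulrCA.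
  by set t := M * _; lra.
rewrite leNgt; apply/negP => h.
have [n] := @geometric_small M (`|x| - half_side) ltac:(by rewrite subr_gt0).
by have := bound n x Kx; lra.
Qed.

Lemma carrier_dist x y : vicsek_carrier K x -> vicsek_carrier K y -> `|x - y| <= 2.
Proof.
move=> /carrier_norm hx /carrier_norm hy.
have := ler_normB x y; have := half_side_lt1 R; lra.
Qed.

Lemma cell_diam w x y : cell w x -> cell w y -> `|x - y| <= 2 * 3 ^- size w.
Proof.
move=> [x' Kx <-] [y' Ky <-]; rewrite psi_word_dist mulrC.
by rewrite ler_pM2r ?invr_gt0 ?exprn_gt0// carrier_dist.
Qed.

Lemma cell_centre w : cell w (psi_word w 0).
Proof. by exists 0 => //; exact: carrier0. Qed.

(** Position of [z] in the window of radius [M] about [z0], as an element of a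
    finite type: it determines [z] inside this window. *)
Definition window (M : nat) (z0 z : int) : 'I_(2 * M).+1 :=
  inord (absz (z - z0 + M%:Z)).

Lemma window_inj (M : nat) (z0 z z' : int) :
  `|z - z0| <= M%:Z -> `|z' - z0| <= M%:Z ->
  window M z0 z = window M z0 z' -> z = z'.
Proof.
move=> h h' /(congr1 val); rewrite /= !inordK; lia.
Qed.

(** Centres of cells lie on a grid, so only boundedly many cells of a given
    level are near a given point. *)
Lemma card_near_cells (n M : nat) (P : pred (n.-tuple 'I_5)) :
  (forall w w' : n.-tuple 'I_5, P w -> P w' ->
    `|psi_word w (0 : 'rV[R]_2) - psi_word w' 0| <= M%:R * 3 ^- n) ->
  (#|P| <= (2 * M).+1 ^ 2)%N.
Proof.
move=> hP; have [w0 Pw0|P0] := pickP P; last by rewrite eq_card0.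
pose g (w : n.-tuple 'I_5) : 'I_(2 * M).+1 * 'I_(2 * M).+1 :=
  (window M (ternary (digit 0) w0) (ternary (digit 0) w),
   window M (ternary (digit 1) w0) (ternary (digit 1) w)).
have close (w : n.-tuple 'I_5) k : P w ->
    `|ternary (digit k) w - ternary (digit k) w0| <= M :> int.
  move=> Pw; rewrite -(ler_int R).
  apply: (@centre_coord_dist R w w0 k); first by rewrite !size_tuple.
  by rewrite size_tuple; exact: hP.
have ginj : {in P &, injective g}.
  move=> w w' Pw Pw' [e0 e1]; apply: val_inj.
  have sww : size w = size w' by rewrite !size_tuple.
  have m k : map (digit k) w = map (digit k) w'.
    apply: ternary_inj sww _ => [i|]; first exact: digit_le1.
    have [->|->] : k = 0 \/ k = 1.
      by case: k => -[|[|]]// ?; [left|right]; apply: val_inj.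
    - by apply: window_inj e0; exact: close.
    - by apply: window_inj e1; exact: close.
  apply: (@eq_from_nth _ 0) => // l lw; apply: digit_inj => k.
  have := congr1 (nth 0 ^~ l) (m k).
  by rewrite !(nth_map 0)// -sww.
rewrite -(card_in_imset ginj) (leq_trans (max_card _))//.
by rewrite card_prod !card_ord expnS expn1.
Qed.

End VicsekSet.

(** * Comparison of the geodesic distance with the norm *)

Section Distance.
Variables (R : realType) (K : vicsekSet R).
Implicit Types (A : set 'rV[R]_2) (L M : R) (x y z : 'rV[R]_2) (w : word).

(** Paths of unit speed for the sup norm, for which concatenating and rescaling
    is straightforward; it costs a factor 2 in the lengths. *)
Definition reach A L x y := exists M (g : R -> 'rV[R]_2),
  [/\ 0 <= M <= L, forall s t, `|g s - g t| <= `|s - t|, g 0 = x, g M = y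
    & forall t, 0 <= t <= M -> A (g t)].

Lemma reach_sym A L x y : reach A L x y -> reach A L y x.
Proof.
move=> [M [g [ML lip g0 gM Ag]]]; exists M, (fun t => g (M - t)); split => //.
- move=> s t; apply: (le_trans (lip _ _)).
  by rewrite [leRHS]distrC (_ : M - s - (M - t) = t - s)//; ring.
- by rewrite subr0.
- by rewrite subrr.
- by move=> t tM; apply: Ag; lra.
Qed.

Lemma reach_cat A L L' x y z :
  reach A L x y -> reach A L' y z -> reach A (L + L') x z.
Proof.
move=> [M [g [ML lip g0 gM Ag]]] [M' [g' [ML' lip' g0' gM' Ag']]].
exists (M + M'), (fun t => if t <= M then g t else g' (t - M)).
have mixed s t : s <= M -> M < t -> `|g s - g' (t - M)| <= `|s - t|.
  move=> sM Mt; apply: (le_trans (ler_distD y _ _)).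
  rewrite -{1}gM -g0'; have := lip s M; have := lip' 0 (t - M).
  rewrite sub0r normrN (ger0_norm (_ : 0 <= t - M)); last by lra.
  rewrite (distrC s M) (ger0_norm (_ : 0 <= M - s)); last by lra.
  rewrite (distrC s t) (ger0_norm (_ : 0 <= t - s)); last by lra.
  by lra.
split.
- by lra.
- move=> s t; have [sM|sM] := leP s M; have [tM|tM] := leP t M => //.
  + exact: mixed.
  + by rewrite distrC (distrC s); exact: mixed.
  + apply: (le_trans (lip' _ _)); rewrite (_ : s - M - (t - M) = s - t)//; ring.
- by rewrite ifT//; lra.
- case: leP => h; last by rewrite (addrC M) addrK.
  have M0 : M' = 0 by lra.
  by rewrite M0 addr0 gM -gM' M0.
- move=> t tM; case: leP => h; first by apply: Ag; lra.
  by apply: Ag'; lra.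
Qed.

Lemma reach_psi i n L x y :
  reach (Vbar n) L x y -> reach (Vbar n.+1) (3^-1 * L) (psi i x) (psi i y).
Proof.
move=> [M [g [ML lip g0 gM Ag]]]; exists (3^-1 * M), (fun t => psi i (g (3 * t))).
split; rewrite ?mulr0 ?g0//.
- by lra.
- move=> s t; rewrite psi_sub normrZ ger0_norm// -[leRHS](mulKf (_ : 3 != 0))//.
  rewrite ler_pM2l// (le_trans (lip _ _))// -mulrBr normrM ger0_norm//.
- by rewrite mulrA divff// mul1r gM.
- move=> t tM; exists i => //; exists (g (3 * t)) => //; apply: Ag; lra.
Qed.

Lemma reach_psi_word w n L x y : reach (Vbar n) L x y ->
  reach (Vbar (size w + n)) (3 ^- size w * L) (psi_word w x) (psi_word w y).
Proof.
move=> h; elim: w => [|i w IH] /=; first by rewrite expr0 invr1 mul1r.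
by rewrite exprS invfM -mulrA; exact: reach_psi.
Qed.

(** A corner is reached from the centre by crossing the central subcell and
    then the subcell of that corner twice, each at a third of the cost: the time
    does not grow with the level of approximation. *)
Lemma reach_corner n (i : 'I_5) : (i < 4)%N -> reach (Vbar n) 1 0 (q R i).
Proof.
elim: n i => [|n IH] i i4.
  exists 1, (fun t => t *: q R i); split.
  - by rewrite ler01 lexx.
  - move=> s t; rewrite -scalerBl normrZ ler_piMr//.
    exact: le_trans (norm_q R i) (ltW (half_side_lt1 R)).
  - by rewrite scale0r.
  - by rewrite scale1r.
  - move=> t t01; exists i => //; exists t; first by rewrite /= in_itv.
    by rewrite q_center scaler0 add0r.
rewrite (_ : 1 = 3^-1 * 1 + (3^-1 * 1 + 3^-1 * 1)); last by field.
have h1 := reach_psi ord_max (IH i i4).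
have h2 := reach_psi i (reach_sym (IH _ (opposite_lt4 i))).
have h3 := reach_psi i (IH i i4).
rewrite psi_center scaler0 in h1; rewrite psi_q in h3; rewrite psi_opposite// in h2.
exact: reach_cat h1 (reach_cat h2 h3).
Qed.

Lemma reach_centre n w : size w = n -> reach (Vbar n) 1 0 (psi_word w 0).
Proof.
elim: n w => [[]//|n IH [|i w]//] => [_|/= [sw]].
  exists 0, (fun=> 0); split => //.
  - by rewrite lexx ler01.
  - by move=> s t; rewrite subrr normr0.
  - move=> t _; exists 0 => //; exists 0; first by rewrite /= in_itv /= lexx ler01.
    by rewrite q_center scaler0 scale0r addr0.
have h3 := reach_psi i (IH w sw).
have [->|ic] := eqVneq i ord_max.
  have [M [g [ML lip g0 gM Ag]]] := reach_psi ord_max (IH w sw).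
  by exists M, g; split => //; [lra|rewrite g0 psi_center scaler0].
have i4 : (i < 4)%N by rewrite lt4_center.
rewrite (_ : 1 = 3^-1 * 1 + (3^-1 * 1 + 3^-1 * 1)); last by field.
have h1 := reach_psi ord_max (reach_corner n i4).
have h2 := reach_psi i (reach_sym (reach_corner n (opposite_lt4 i))).
rewrite psi_center scaler0 in h1; rewrite psi_opposite// in h2.
exact: reach_cat h1 (reach_cat h2 h3).
Qed.

Lemma Vbar_centre n w : size w = n -> Vbar n (psi_word w (0 : 'rV[R]_2)).
Proof. by move=> /reach_centre[M [g [M0 _ _ <- Ag]]]; apply: Ag; lra. Qed.

(** From the first centre to that of its cell, to the common corner, to the
    centre of the other cell, and to the second centre. *)
Lemma reach_adjacent n w w' v v' : size w = n -> size w' = n ->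
  size v = size v' -> adjacent R w w' ->
  reach (Vbar (n + size v)) (4 * 3 ^- n) (psi_word (w ++ v) 0) (psi_word (w' ++ v') 0).
Proof.
move=> sw sw' svv' [i [j [i4 j4 e]]]; rewrite !psi_word_cat.
rewrite (_ : 4 * _ = 3 ^- n * 1 + (3 ^- n * 1 + (3 ^- n * 1 + 3 ^- n * 1))).
  have h1 := reach_psi_word w (reach_sym (reach_centre (erefl (size v)))).
  have h2 := reach_psi_word w (reach_corner (size v) i4).
  have h3 := reach_psi_word w' (reach_sym (reach_corner (size v) j4)).
  have h4 := reach_psi_word w' (reach_centre (esym svv')).
  rewrite sw in h1 h2; rewrite sw' in h3 h4; rewrite e in h2.
  exact: reach_cat h1 (reach_cat h2 (reach_cat h3 h4)).
by field; rewrite expf_neq0.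
Qed.

Lemma norm_le_edist x y : `|x - y| <= Defs.edist x y.
Proof.
apply: rV2_norm_le; first exact: sqrtr_ge0.
move=> k; rewrite /Defs.edist -sqrtr_sqr ler_wsqrtr// (bigD1 k)//= !mxE lerDl.
by apply: sumr_ge0 => j _; exact: sqr_ge0.
Qed.

Lemma edist_le x y : Defs.edist x y <= 2 * `|x - y|.
Proof.
rewrite -[leRHS]ger0_norm ?mulr_ge0// -sqrtr_sqr ler_wsqrtr//.
rewrite !big_ord_recl big_ord0 addr0.
have h k : (x 0 k - y 0 k) ^+ 2 <= `|x - y| ^+ 2.
  rewrite -real_normK ?num_real// ler_pXn2r ?nnegrE//.
  by have := coord_le_norm (x - y) k; rewrite !mxE.
have := h ord0; have := h (lift ord0 ord0); have := sqr_ge0 `|x - y|; lra.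
Qed.

Lemma reach_path_length A L x y : reach A L x y ->
  exists2 g, path_in A x y g & (path_length g <= (2 * L)%:E)%E.
Proof.
move=> [M [g [ML lip g0 gM Ag]]].
have M0 : 0 <= M by lra.
exists (fun t => g (M * t)).
  split; rewrite ?mulr0 ?mulr1//.
  - apply: continuous_subspaceT => t; apply/cvgrPdist_lt => e e0.
    near=> u; apply: (le_lt_trans (lip _ _)).
    rewrite -mulrBr normrM ger0_norm// (@le_lt_trans _ _ ((M + 1) * `|t - u|))//.
      by rewrite ler_wpM2r//; lra.
    rewrite mulrC -ltr_pdivlMr; last by lra.
    near: u; apply: cvgr_dist_lt => //; rewrite divr_gt0//; lra.
  - move=> _ [t /= t01 <-]; apply: Ag; move: t01; rewrite in_itv /= => /andP[t0 t1].
    by rewrite mulr_ge0//= ler_piMr.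
apply: ge_ereal_sup => _ [t [pt /eqP lt] <-]; rewrite lee_fin.
have sum_le (a : R) (s : seq R) : path <%O a s ->
    \sum_(k < size s) Defs.edist (g (M * (a :: s)`_k)) (g (M * s`_k)) <=
    2 * (M * (last a s - a)).
  elim: s a => [|b s IH] a /=; first by rewrite big_ord0 subrr !mulr0.
  move=> /andP[ab pb]; rewrite big_ord_recl /=.
  rewrite (_ : 2 * (M * (last b s - a)) =
    2 * (M * (b - a)) + 2 * (M * (last b s - b))); last by ring.
  apply: lerD; last exact: IH.
  apply: (le_trans (edist_le _ _)); rewrite ler_pM2l// (le_trans (lip _ _))//.
  by rewrite -mulrBr normrM ger0_norm// ler_wpM2l// distrC ger0_norm// subr_ge0 ltW.
apply: (le_trans (sum_le 0 t pt)); rewrite lt subr0 mulr1; lra.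
Unshelve. all: by end_near. Qed.

Lemma edist_le_path_length (g : R -> 'rV[R]_2) :
  ((Defs.edist (g 0%R) (g 1%R))%:E <= path_length g)%E.
Proof.
apply: ereal_sup_ubound; exists [:: 1]; last by rewrite big_ord_recl big_ord0 addr0.
exact/itv_partition1/ltr01.
Qed.

Lemma vicsek_nbhs (x : vicsekType K) (U : set (vicsekType K)) : nbhs x U ->
  exists2 e : R, 0 < e & forall y : vicsekType K, `|vval y - vval x| < e -> U y.
Proof.
rewrite nbhsE => -[V [[W oW WV] Vx] VU].
have : nbhs (vval x) W by apply: open_nbhs_nbhs; split => //; move: Vx; rewrite -WV.
move=> /nbhs_ballP[e /= e0 eW]; exists e => // y xy; apply: VU; rewrite -WV.
by apply: eW; rewrite -ball_normE /= distrC.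
Qed.

Lemma vvalP (x : vicsekType K) : vicsek_carrier K (vval x).
Proof. exact: set_valP. Qed.

Lemma vval_surj z : vicsek_carrier K z -> exists x : vicsekType K, vval x = z.
Proof. by move=> Kz; exists (exist _ z (mem_set Kz)). Qed.

Variable d : vicsekType K -> vicsekType K -> R.
Hypothesis hd : geodesic_distance d.

Lemma distance_cont (x y : vicsekType K) (e : R) : 0 < e ->
  exists2 r : R, 0 < r & forall x' y' : vicsekType K, `|vval x' - vval x| < r ->
    `|vval y' - vval y| < r -> `|d x' y' - d x y| < e.
Proof.
move=> e0; have [dc _] := hd.
have /cvgrPdist_lt/(_ e e0) := dc (x, y).
move=> [[/= A B] [/= /vicsek_nbhs[a a0 aA] /vicsek_nbhs[b b0 bB]] AB].
exists (Num.min a b); first by rewrite lt_min a0.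
move=> x' y'; rewrite !lt_min => /andP[xa _] /andP[_ yb].
by have := AB (x', y') (conj (aA _ xa) (bB _ yb)); rewrite /= distrC.
Qed.

Lemma centre_approx w (x : vicsekType K) n : cell K w (vval x) ->
  exists v (z : vicsekType K), [/\ size v = n, vval z = psi_word (w ++ v) 0
    & `|vval z - vval x| <= 2 * 3 ^- n].
Proof.
move=> /(cell_split n)[v sv cx].
have [z zE] := vval_surj (cell_sub (cell_centre K (w ++ v))).
exists v, z; split => //; rewrite zE.
apply: (le_trans (cell_diam (cell_centre K _) cx)).
rewrite ler_pM2l// lef_pV2 ?posrE ?exprn_gt0// ler_eXn2l ?ltr1n// size_cat sv.
exact: leq_addl.
Qed.

(** True between centres of small cells since a curve is at least as long as
    its chord, and elsewhere by continuity. *)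
Lemma distance_ge (x y : vicsekType K) : `|vval x - vval y| <= d x y.
Proof.
rewrite leNgt; apply/negP => h.
pose e := (`|vval x - vval y| - d x y) / 4.
have e0 : 0 < e by rewrite divr_gt0// subr_gt0.
have [r r0 hr] := distance_cont x y e0.
have [n hn] := @geometric_small R 2 (Num.min e r) ltac:(by rewrite lt_min e0).
have [v [x' [sv x'E xx']]] : exists v (z : vicsekType K), [/\ size v = n,
    vval z = psi_word ([::] ++ v) 0 & `|vval z - vval x| <= 2 * 3 ^- n].
  by apply: centre_approx; rewrite cell_nil; exact: vvalP.
have [v' [y' [sv' y'E yy']]] : exists v (z : vicsekType K), [/\ size v = n,
    vval z = psi_word ([::] ++ v) 0 & `|vval z - vval y| <= 2 * 3 ^- n].
  by apply: centre_approx; rewrite cell_nil; exact: vvalP.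
move: hn; rewrite lt_min => /andP[he hr'].
have := hr x' y' (le_lt_trans xx' hr') (le_lt_trans yy' hr').
have [_ /(_ n x' y')] := hd; rewrite x'E y'E.
move=> /(_ (Vbar_centre sv) (Vbar_centre sv'))[g [[_ g0 g1 _] _] dE].
have := edist_le_path_length g; rewrite g0 g1 dE lee_fin.
have := norm_le_edist (vval x') (vval y'); rewrite x'E y'E -x'E -y'E.
have := ler_distD (vval x') (vval x) (vval y).
have := ler_distD (vval y') (vval x') (vval y).
have eE : 4 * e = `|vval x - vval y| - d x y by rewrite /e; field.
by rewrite (distrC (vval x) (vval x')) ltr_norml; lra.
Qed.

(** Between centres of small subcells the geodesic is at most as long as the
    path through the common corner, and the general case follows by
    continuity. *)
Lemma distance_le n w w' (x y : vicsekType K) : size w = n -> size w' = n ->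
  adjacent R w w' -> cell K w (vval x) -> cell K w' (vval y) ->
  d x y <= 8 * 3 ^- n.
Proof.
move=> sw sw' ww' wx wy; rewrite leNgt; apply/negP => h.
have [r r0 hr] := @distance_cont x y (d x y - 8 * 3 ^- n) ltac:(by rewrite subr_gt0).
have [m hm] := geometric_small 2 r0.
have [v [x' [sv x'E xx']]] := centre_approx m wx.
have [v' [y' [sv' y'E yy']]] := centre_approx m wy.
have := hr x' y' (le_lt_trans xx' hm) (le_lt_trans yy' hm).
have [_ /(_ (n + m)%N x' y')] := hd; rewrite x'E y'E.
have sz (u u' : word) : size u = n -> size u' = m -> size (u ++ u') = (n + m)%N.
  by move=> su su'; rewrite size_cat su su'.
move=> /(_ (Vbar_centre (sz w v sw sv))
  (Vbar_centre (sz w' v' sw' sv')))[g [_ ming] dE].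
have := reach_adjacent sw sw' (etrans sv (esym sv')) ww'; rewrite sv.
move=> /reach_path_length[g' /ming]; rewrite dE => h1 h2.
have := le_trans h1 h2; rewrite lee_fin ltr_norml; lra.
Qed.

End Distance.

(** * Integrals *)

Section Integrals.
Context d (T : measurableType d) (R : realType).
Variable mu : {measure set T -> \bar R}.
Local Open Scope ereal_scope.
Implicit Types (A D : set T) (f : T -> R) (g h : T -> \bar R).

(** Integrals of nonnegative functions are suprema of integrals of simple
    functions, so monotonicity holds without measurability. The
    estimates of the energy therefore never ask whether its integrand is
    measurable. *)
Lemma ge0_le_integral_any D g h : (forall x, D x -> 0 <= g x) ->
  (forall x, D x -> g x <= h x) ->
  \int[mu]_(x in D) g x <= \int[mu]_(x in D) h x.
Proof.
move=> g0 gh.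
have h0 x : D x -> 0 <= h x by move=> Dx; exact: le_trans (g0 _ Dx) (gh _ Dx).
rewrite !ge0_integralE//; apply: ereal_sup_le => _ [k kg <-].
exists k => // x; apply: (le_trans (kg x)); rewrite /patch.
by case: ifPn => // /[!inE]; exact: gh.
Qed.

Lemma integral_sum_cells (I : finType) (P : pred I) (B : I -> set T)
    (h : I -> T -> \bar R) :
  (forall i, measurable (B i)) -> (forall i, measurable_fun setT (h i)) ->
  (forall i x, 0 <= h i x) ->
  \sum_(i | P i) \int[mu]_(x in B i) h i x =
  \int[mu]_x (\sum_(i | P i) (h i \_ (B i)) x).
Proof.
move=> mB mh h0; under [RHS]eq_integral do rewrite big_mkcond /=.
rewrite [RHS](_ : _ = \int[mu]_x (\sum_(i <- index_enum I)
    (if P i then h i \_ (B i) else cst 0) x)).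
  rewrite ge0_integral_sum//.
  - rewrite big_mkcond /=; apply: eq_bigr => i _; case: ifP => _.
      by rewrite -integral_mkcond.
    by rewrite integral0.
  - move=> i; case: ifP => _ //; apply/(measurable_restrictT _ (mB i)).
    exact: measurable_funS (mh i).
  - move=> i x _; case: ifP => _ //; rewrite /patch; by case: ifP.
by apply: eq_integral => x _; apply: eq_bigr => i _; case: ifP.
Qed.

Lemma integral_cover (I : finType) (P : pred I) (B : I -> set T) A h :
  (forall i, measurable (B i)) ->
  measurable_fun setT h -> (forall x, 0 <= h x) ->
  (forall x, A x -> exists2 i, P i & B i x) ->
  \int[mu]_(x in A) h x <= \sum_(i | P i) \int[mu]_(x in B i) h x.
Proof.
move=> mB mh h0 AB; rewrite integral_sum_cells// integral_mkcond.
apply: ge0_le_integral_any => x _; rewrite {1}/patch; case: ifPn => //.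
  move=> /[!inE] Ax; have [i Pi Bi] := AB x Ax.
  rewrite (bigD1 i)//= {1}/patch mem_set// leeDl//.
  by apply: sume_ge0 => j _; rewrite /patch; case: ifP.
by move=> _; apply: sume_ge0 => j _; rewrite /patch; case: ifP.
Qed.

(** Local bounds add up to a global one when the sets overlap at most [C]
    times, as every point is then counted at most [C] times. *)
Lemma integral_multiplicity (I : finType) (P : pred I) (B : I -> set T)
    (h : I -> T -> \bar R) g (C : nat) (c : R) :
  (forall i, measurable (B i)) -> (forall i, measurable_fun setT (h i)) ->
  (forall i x, 0 <= h i x) -> (forall x, 0 <= g x) -> (0 < C)%N -> (0 < c)%R ->
  (forall i x, P i -> B i x -> h i x <= c%:E * g x) ->
  (forall x, #|[pred i | P i & x \in B i]| <= C)%N ->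
  \sum_(i | P i) \int[mu]_(x in B i) h i x <= (C%:R * c)%:E * \int[mu]_x g x.
Proof.
move=> mB mh h0 g0 C0 c0 hg hC; rewrite integral_sum_cells//.
have k0 : (0 < C%:R * c)%R by rewrite mulr_gt0// ltr0n.
have s0 x : 0 <= \sum_(i | P i) (h i \_ (B i)) x.
  by apply: sume_ge0 => j _; rewrite /patch; case: ifP.
have ms : measurable_fun setT (fun x => \sum_(i | P i) (h i \_ (B i)) x).
  under eq_fun do rewrite big_mkcond /=.
  apply: emeasurable_sum => i; case: (P i) => //.
  by apply/(measurable_restrictT _ (mB i)); exact: measurable_funS (mh i).
rewrite -lee_pdivrMl// -ge0_integralZl// ?lee_fin ?invr_ge0 ?(ltW k0)//.
apply: ge0_le_integral_any => x _.
  by rewrite mule_ge0// lee_fin invr_ge0 ltW.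
rewrite lee_pdivrMl// EFinM -muleA /patch -big_mkcondr /=.
have natl (z : \bar R) n : GRing.natmul z n = n%:R%:E * z.
  elim: n => [|n IH]; first by rewrite mulr0n mul0e.
  by rewrite mulrS IH -natr1 addrC EFinD ge0_muleDl ?lee_fin// mul1e.
have cg0 : 0 <= c%:E * g x by rewrite mule_ge0// lee_fin ltW.
apply: (@le_trans _ _ (\sum_(i in [pred i | P i & x \in B i]) (c%:E * g x))).
  by apply: lee_sum => i /andP[Pi /set_mem]; exact: hg.
by rewrite sumr_const natl lee_wpmul2r// lee_fin ler_nat hC.
Qed.

(** The graph of the power function lies above its tangent line at [X]. *)
Lemma powR_tangent (p t X : R) : (1 <= p)%R -> (0 <= t)%R -> (0 <= X)%R ->
  (p * (t * X `^ (p - 1)) <= t `^ p + (p - 1) * X `^ p)%R.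
Proof.
move=> p1 t0 X0; have [->|pN1] := eqVneq p 1%R.
  by rewrite subrr powRr0 mulr1 mul1r mul0r addr0 powRr1.
have {pN1} p1' : (1 < p)%R by rewrite lt_neqAle eq_sym pN1.
pose q := (p / (p - 1))%R.
have p0 : (0 < p)%R by lra.
have pm0 : (0 < p - 1)%R by lra.
have q0 : (0 < q)%R by rewrite divr_gt0.
have pq : (p^-1 + q^-1 = 1)%R by rewrite /q; field; rewrite !gt_eqF.
have := conjugate_powR t0 (powR_ge0 X (p - 1)) p0 q0 pq.
rewrite -powRrM (_ : (p - 1) * q = p)%R; last by rewrite /q; field; rewrite gt_eqF.
move=> /(ler_wpM2l (ltW p0)) h; apply: (le_trans h).
by rewrite le_eqVlt; apply/orP; left; apply/eqP; rewrite /q; field; rewrite !gt_eqF.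
Qed.

(** Jensen's inequality for the average [a] of [f] on [A], by integrating the
    tangent line inequality at the distance from [a] to [c]. *)
Lemma jensen_average A f (a c m p : R) : measurable A -> mu A = m%:E ->
  (1 <= p)%R -> mu.-integrable setT (EFin \o f) ->
  \int[mu]_(x in A) (f x)%:E = (a * m)%:E ->
  (`|a - c| `^ p * m)%:E <= \int[mu]_(x in A) (`|f x - c| `^ p)%:E.
Proof.
move=> mA mAE p1 fi fa.
have m0 : (0 <= m)%R by rewrite -lee_fin -mAE.
have mf : measurable_fun setT f by apply/measurable_EFinP; case/integrableP: fi.
have fiA : mu.-integrable A (EFin \o f) by apply: integrableS fi.
have mfc : measurable_fun A (fun x => f x - c)%R.
  by apply: measurable_funB => //; exact: measurable_funS mf.
have mp : measurable_fun A (fun x => `|f x - c| `^ p)%R.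
  apply: (measurableT_comp (measurable_powR _)) => //.
  exact: measurableT_comp.
have ci : mu.-integrable A (EFin \o cst c).
  apply/integrableP; split; first exact/measurable_EFinP.
  by rewrite (integral_cst mu mA `|c|%:E) mAE ltry.
have dev : \int[mu]_(x in A) (f x - c)%:E = ((a - c) * m)%:E.
  rewrite mulrBl EFinB -fa; under eq_integral do rewrite EFinB.
  by rewrite integralB_EFin//= (integral_cst mu mA c%:E) mAE.
have dev1 : (`|a - c| * m)%:E <= \int[mu]_(x in A) `|f x - c|%:E.
  have := @le_abse_integral _ _ _ mu A (EFin \o (fun x => f x - c)%R) mA.
  move=> /(_ ltac:(exact/measurable_EFinP)).
  by rewrite /= dev abse_EFin normrM (ger0_norm m0).
(* the tangent line at X = |a - c|, integrated over A *)
set I := \int[mu]_(x in A) _ in dev1 *.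
set X := `|a - c|%R in dev1 *; set J := \int[mu]_(x in A) _.
have X0 : (0 <= X)%R by exact: normr_ge0.
have J0 : 0 <= J by apply: integral_ge0 => x _; rewrite lee_fin powR_ge0.
have [->|Jfin] := eqVneq J +oo; first by rewrite leey.
have {Jfin}Jfin : J \is a fin_num by rewrite ge0_fin_numE// ltey.
have tangent : (p * X `^ (p - 1))%:E * I <= J + ((p - 1) * X `^ p * m)%:E.
  rewrite -ge0_integralZl//; last by rewrite lee_fin mulr_ge0 ?powR_ge0//; lra.
    rewrite [X in _ <= _ + X]EFinM -[m%:E]mAE -(integral_cst mu mA).
    rewrite -ge0_integralD//; last 2 first.
    - exact/measurable_EFinP.
    - by move=> x _; rewrite lee_fin mulr_ge0 ?powR_ge0//; lra.
    apply: ge0_le_integral_any => x _.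
      by rewrite lee_fin !mulr_ge0 ?powR_ge0//; lra.
    rewrite -EFinM -EFinD lee_fin.
    have := powR_tangent p1 (normr_ge0 (f x - c)%R) X0.
    by rewrite [(`|_| * _)%R]mulrC mulrA.
  exact/measurable_EFinP/measurableT_comp.
have := le_trans (lee_wpmul2l _ dev1) tangent.
rewrite lee_fin mulr_ge0 ?powR_ge0//; last by lra.
move=> /(_ isT); rewrite -(fineK Jfin) -EFinM -EFinD !lee_fin.
have -> : (p * X `^ (p - 1) * (X * m) = p * X `^ p * m)%R.
  have [->|XN0] := eqVneq X 0%R.
    by rewrite mul0r mulr0 powR0 ?mulr0 ?mul0r// gt_eqF//; lra.
  have -> : (X `^ p = X `^ (p - 1) * X)%R.
    rewrite -[X in (_ * X)%R]powRr1// -powRD ?subrK//.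
    by apply/implyP.
  ring.
lra.
Qed.

Lemma measurable_powR_dist A f (c p : R) : measurable_fun setT f ->
  measurable_fun A (fun x => (`|f x - c| `^ p)%:E).
Proof.
move=> mf; apply/measurable_EFinP.
apply: (measurableT_comp (measurable_powR p)); apply: measurableT_comp => //.
by apply: measurable_funB => //; exact: measurable_funS mf.
Qed.

Lemma integral_powR_shift A f (b c p : R) : measurable A ->
  measurable_fun setT f -> (1 <= p)%R ->
  \int[mu]_(x in A) (`|f x - c| `^ p)%:E <= (2 `^ p)%:E *
    (\int[mu]_(x in A) (`|f x - b| `^ p)%:E + (`|b - c| `^ p)%:E * mu A).
Proof.
move=> mA mf p1; rewrite -(integral_cst mu mA) -ge0_integralD//; last 2 first.
- exact: measurable_powR_dist.
- by move=> x _; rewrite lee_fin powR_ge0.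
rewrite -ge0_integralZl//; last 2 first.
- by apply: emeasurable_funD => //; exact: measurable_powR_dist.
- by move=> x _; rewrite adde_ge0// lee_fin powR_ge0.
apply: ge0_le_integral_any => x _; first by rewrite lee_fin powR_ge0.
rewrite /= -EFinD -EFinM lee_fin.
by have := powR_normD (f x - b) (b - c) p1; rewrite addrA subrK.
Qed.

End Integrals.

(** * Measure of cells and balls *)

Section VicsekMeasure.
Variables (R : realType) (K : vicsekSet R).
Implicit Types (w : word) (x y : vicsekType K).

Lemma vval_continuous : continuous (@vval R K).
Proof. exact: initial_continuous. Qed.

Lemma psi_word_continuous w : continuous (@psi_word R w).
Proof.
have -> : psi_word w = (fun x : 'rV[R]_2 => 3 ^- size w *: x + psi_word w 0).
  by apply/funext => x; rewrite -[X in _ *: X]subr0 -psi_word_sub subrK.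
move=> x; have FF : Filter (nbhs x) by exact: nbhs_filter.
apply: cvgD; last exact: cvg_cst.
by apply: cvgZ; [exact: cvg_cst|exact: cvg_id].
Qed.

Definition pcell w : set (vicsekBorel K) := @vval R K @^-1` cell K w.

Lemma open_measurable_vicsek (U : set (vicsekBorel K)) :
  open (U : set (vicsekType K)) -> measurable U.
Proof. by move=> oU; exact: sub_sigma_algebra. Qed.

Lemma pcell_measurable w : measurable (pcell w).
Proof.
rewrite -[pcell w]setCK; apply: measurableC; apply: open_measurable_vicsek.
apply: (proj1 (continuousP _) vval_continuous (~` cell K w)).
apply: closed_openC; apply: compact_closed => //; apply: continuous_compact.
  by apply: continuous_subspaceT => x; exact: psi_word_continuous.
exact: vicsek_compact.
Qed.

Lemma pcell_nil : pcell [::] = setT.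
Proof. by rewrite /pcell cell_nil; apply/seteqP; split => // x _; exact: vvalP. Qed.

Lemma pcell_cover u n x : pcell u x ->
  exists t : n.-tuple 'I_5, pcell (u ++ t) x.
Proof.
move=> /(cell_split n)[w sw wx].
by exists (tcast sw (in_tuple w)); rewrite val_tcast.
Qed.

(** Radii between 9 * 3 ^- n and 27 * 3 ^- n are attached to the level [n], so
    these cells cover the ball of such a radius about [x]. *)
Definition near_cells n (x : 'rV[R]_2) : {set n.-tuple 'I_5} :=
  [set w : n.-tuple 'I_5 |
    `[< exists2 y, cell K w y & `|y - x| <= 27 * 3 ^- n >]].

Lemma card_near_cells_le : exists2 C : nat, (0 < C)%N &
  forall n z, (#|near_cells n z| <= C)%N.
Proof.
(* 58 = 27 + 27 for the distances to x, and 2 + 2 for the diameters *)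
exists ((2 * 58).+1 ^ 2)%N; first by rewrite expn_gt0.
move=> n x; apply: (@card_near_cells R n 58) => w w' Pw Pw'.
have : w \in near_cells n x by []; have : w' \in near_cells n x by [].
rewrite !inE => -[y' wy' yx'] [y wy yx].
have := cell_diam wy (cell_centre K w); have := cell_diam (cell_centre K w') wy'.
rewrite !size_tuple => h1 h2.
apply: (le_trans (ler_distD y _ _)); rewrite distrC.
have := ler_distD x y (psi_word w' 0); have := ler_distD y' x (psi_word w' 0).
by rewrite (distrC x y') (distrC y' (psi_word w' 0)); lra.
Qed.

Lemma near_cells_mem n (w : n.-tuple 'I_5) (x : 'rV[R]_2) :
  cell K w x -> w \in near_cells n x.
Proof.
move=> wx; rewrite inE; apply/asboolP; exists x => //.
by rewrite subrr normr0 mulr_ge0.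
Qed.

Lemma near_cells_adjacent n (w w' : n.-tuple 'I_5) (x : 'rV[R]_2) :
  cell K w x -> adjacent R w w' -> w' \in near_cells n x.
Proof.
move=> wx [i [j [_ _ e]]]; rewrite inE; apply/asboolP.
have cw v k : cell K v (psi_word v (q R k)) by exists (q R k) => //; exact: carrier_q.
exists (psi_word w (q R i)); first by rewrite e.
have := cell_diam (cw w i) wx; rewrite size_tuple => h; apply: (le_trans h).
by rewrite ler_pM2r ?invr_gt0 ?exprn_gt0// ler_nat.
Qed.

Lemma card_pcell_le (C : nat) (n : nat) x : (forall n z, (#|near_cells n z| <= C)%N) ->
  (#|[pred w : n.-tuple 'I_5 | x \in pcell w]| <= C)%N.
Proof.
move=> hC; apply: leq_trans (hC n (vval x)); apply: subset_leq_card.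
by apply/fintype.subsetP => w /set_mem wx; exact: near_cells_mem.
Qed.

Variable d : vicsekType K -> vicsekType K -> R.
Variable mu : {measure set (vicsekBorel K) -> \bar R}.
Hypothesis hd : geodesic_distance d.
Hypothesis hmu : normalized_measure mu.

Lemma mu_pcell w : mu (pcell w) = (5 ^- size w)%:E.
Proof. exact: hmu. Qed.

Lemma mu_setT : mu setT = 1%E.
Proof. by rewrite -pcell_nil mu_pcell expr0 invr1. Qed.

Lemma dball_measurable x (r : R) : measurable (dball d x r).
Proof.
apply: open_measurable_vicsek.
have dc : continuous (d x).
  move=> y; have FF : Filter (nbhs y) by exact: nbhs_filter.
  apply/cvgrPdist_lt => e e0; have [rho rho0 h] := distance_cont hd x y e0.
  have near_y := vval_continuous (nbhsx_ballx (vval y) rho rho0).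
  apply: (@filterS _ (nbhs y) FF _ _ _ near_y) => y'; rewrite /= -ball_normE /= => yy'.
  by rewrite distrC h// ?subrr ?normr0// distrC.
have := proj1 (continuousP _) dc _ (@open_lt R r).
by congr open.
Qed.

(** The geodesic distance dominates the norm, so the ball is contained in a norm
    ball that is covered by boundedly many cells of level [n]. *)
Lemma mu_dball_le (C : nat) n x (r : R) : (forall n z, (#|near_cells n z| <= C)%N) ->
  r < 27 * 3 ^- n -> (mu (dball d x r) <= (C%:R * 5 ^- n)%:E)%E.
Proof.
move=> hC rn; rewrite -[mu _]mul1e -(integral_cst mu (dball_measurable x r)).
have cover := @integral_cover _ _ _ mu (n.-tuple 'I_5)
  (fun w : n.-tuple 'I_5 => w \in near_cells n (vval x))
  (fun w : n.-tuple 'I_5 => pcell w) (dball d x r) (cst 1%E).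
apply: le_trans.
  apply: cover => //; first by move=> w; exact: pcell_measurable.
  move=> y xy; have [w wy] : exists t : n.-tuple 'I_5, pcell ([::] ++ t) y.
    by apply: pcell_cover; rewrite pcell_nil.
  exists w => //=; rewrite inE; apply/asboolP; exists (vval y) => //.
  by rewrite distrC (le_trans (distance_ge hd x y))// ltW// (lt_trans _ rn).
under eq_bigr => w _ do rewrite (integral_cst mu (pcell_measurable w)) mul1e mu_pcell size_tuple.
rewrite sumEFin lee_fin sumr_const -[leLHS]mulr_natl ler_wpM2r ?invr_ge0//.
by rewrite ler_nat; exact: hC.
Qed.

Lemma mu_dball_fin x (r : R) : mu (dball d x r) \is a fin_num.
Proof.
rewrite ge0_fin_numE//; apply: (@le_lt_trans _ _ (mu setT)).
  by apply: le_measure; rewrite ?inE//; exact: dball_measurable.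
by rewrite mu_setT ltry.
Qed.

End VicsekMeasure.

Arguments pcell {R} K w _.

(** * Oscillation and Poincare inequality on a cell *)

Section TupleCat.
Variables (V : nmodType) (F : word -> V).

Lemma sum_tuple_cat k m :
  \sum_(w : (k + m).-tuple 'I_5) F w =
  \sum_(u : k.-tuple 'I_5) \sum_(t : m.-tuple 'I_5) F (u ++ t).
Proof.
rewrite pair_big /=.
pose h (ut : k.-tuple 'I_5 * m.-tuple 'I_5) := cat_tuple ut.1 ut.2.
rewrite (reindex h)//=.
have st (w : (k + m).-tuple 'I_5) : size (take k w) == k.
  by rewrite size_takel// size_tuple leq_addr.
have sd (w : (k + m).-tuple 'I_5) : size (drop k w) == m.
  by rewrite size_drop size_tuple addKn.
exists (fun w => (Tuple (st w), Tuple (sd w))) => [[u t] _|w _].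
  by congr pair; apply: val_inj; rewrite /= ?take_size_cat ?drop_size_cat ?size_tuple.
by apply: val_inj; rewrite /= cat_take_drop.
Qed.

End TupleCat.

Section CellOscillation.
Variables (R : realType) (K : vicsekSet R).
Variable d : vicsekType K -> vicsekType K -> R.
Variable mu : {measure set (vicsekBorel K) -> \bar R}.
Hypothesis hd : geodesic_distance d.
Hypothesis hmu : normalized_measure mu.
Variables (p : R) (f : vicsekBorel K -> R).
Hypothesis p1 : 1 <= p.
Hypothesis fp : f \in Lfun mu p%:E.

Lemma Lfun_measurable : measurable_fun setT f.
Proof. by have := fp; rewrite inE => /andP[/[!inE]]. Qed.
Let mf := Lfun_measurable.

Lemma Lfun_integrable1 : mu.-integrable setT (EFin \o f).
Proof.
apply/Lfun1_integrable; apply: (@Lfun_subset _ _ _ mu 1%E p%:E) => //.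
by rewrite (mu_setT hmu).
Qed.
Let fi := Lfun_integrable1.

(** The factor is the inverse of the mass of the cell. *)
Definition average (w : word) : R :=
  fine (\int[mu]_(x in pcell K w) (f x)%:E) * 5 ^+ size w.

Lemma average_integral w :
  (\int[mu]_(x in pcell K w) (f x)%:E)%E = (average w * 5 ^- size w)%:E.
Proof.
rewrite /average mulfK ?expf_neq0// fineK//; apply: integrable_fin_num.
  exact: pcell_measurable.
by apply: integrableS fi => //; exact: pcell_measurable.
Qed.

Lemma jensen_cell w (c : R) :
  ((`|average w - c| `^ p * 5 ^- size w)%:E <=
    \int[mu]_(x in pcell K w) (`|f x - c| `^ p)%:E)%E.
Proof.
apply: jensen_average => //; [exact: pcell_measurable|exact: mu_pcell|].
exact: average_integral.
Qed.

Lemma cell_powR_shift w (b c : R) :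
  (\int[mu]_(x in pcell K w) (`|f x - c| `^ p)%:E <= (2 `^ p)%:E *
    (\int[mu]_(x in pcell K w) (`|f x - b| `^ p)%:E +
     (`|b - c| `^ p * 5 ^- size w)%:E))%E.
Proof.
have := integral_powR_shift mu b c (pcell_measurable (K := K) w) mf p1.
by rewrite (mu_pcell hmu) EFinM.
Qed.

Lemma integral_powR_fin w (c : R) :
  (\int[mu]_(x in pcell K w) (`|f x - c| `^ p)%:E)%E \is a fin_num.
Proof.
rewrite ge0_fin_numE; last by apply: integral_ge0 => x _; rewrite lee_fin powR_ge0.
apply: (le_lt_trans (cell_powR_shift w 0 c)).
have ip : (\int[mu]_(x in pcell K w) (`|f x - 0| `^ p)%:E < +oo)%E.
  under eq_integral do rewrite subr0.
  apply: integrable_lty; first exact: pcell_measurable.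
  apply: (integrableS measurableT) => //; first exact: pcell_measurable.
  exact: Lfun_integrable.
rewrite lte_mul_pinfty ?lee_fin ?powR_ge0//.
by apply: lte_add_pinfty => //; rewrite ltry.
Qed.

(** The averages over all adjacent cells, and not only over [w], are included so
    that the oscillation also controls the differences of adjacent averages. *)
Definition oscillation (n : nat) (w : word) : R :=
  \sum_(w' : n.-tuple 'I_5 | `[< adjacent R w w' >])
    fine (\int[mu]_(x in pcell K w) (`|f x - average w'| `^ p)%:E).

Lemma oscillation_ge0 n w : 0 <= oscillation n w.
Proof.
apply: sumr_ge0 => w' _; apply: fine_ge0; apply: integral_ge0 => x _.
by rewrite lee_fin powR_ge0.
Qed.

Lemma oscillation_adjacent n w w' : size w' = n -> adjacent R w w' ->
  (\int[mu]_(x in pcell K w) (`|f x - average w'| `^ p)%:E <=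
    (oscillation n w)%:E)%E.
Proof.
move=> sw' ww'; rewrite -(fineK (integral_powR_fin _ _)) lee_fin.
have vE : val (tcast sw' (in_tuple w')) = w' by rewrite /= val_tcast.
rewrite /oscillation (bigD1 (tcast sw' (in_tuple w')))/=; last first.
  by rewrite val_tcast; apply/asboolP.
rewrite val_tcast lerDl; apply: sumr_ge0 => v _; apply: fine_ge0.
by apply: integral_ge0 => x _; rewrite lee_fin powR_ge0.
Qed.

Lemma average_adjacent n w w' : size w = n -> size w' = n -> adjacent R w w' ->
  `|average w' - average w| `^ p <= 5 ^+ n * oscillation n w.
Proof.
move=> sw sw' ww'; have := le_trans (jensen_cell w _) (oscillation_adjacent sw' ww').
by rewrite lee_fin sw distrC -ler_pdivlMr ?invr_gt0 ?exprn_gt0// invrK mulrC.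
Qed.

(** The averages over two subcells of [u] are compared along a chain of at
    most 3 ^ m adjacent cells. *)
Lemma average_chain (u : word) m (w : word) : size w = m ->
  `|average (u ++ nseq m ord0) - average (u ++ w)| `^ p <=
  (3 ^+ m) `^ (p - 1) *
    (5 ^+ (size u + m) * \sum_(t : m.-tuple 'I_5) oscillation (size u + m) (u ++ t)).
Proof.
move=> sw; rewrite mulr_sumr.
apply: (@chain_estimate (fun v v' => `[< adjacent R v v' >]) _ _ _ R p average
  (fun v => 5 ^+ (size u + m) * oscillation (size u + m) v)) => //.
- by move=> i v v' /asboolP h; apply/asboolP; exact: (adjacent_cat [:: i] h).
- by move=> i k i4; apply/asboolP; exact: adjacent_center.
- by move=> i k i4; apply/asboolP/adjacent_sym; exact: adjacent_center.
- by move=> v; rewrite mulr_ge0 ?oscillation_ge0.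
- move=> v v' /asboolP vv' sv sv'; apply: average_adjacent.
  + by rewrite size_cat sv.
  + by rewrite size_cat sv'.
  + exact: adjacent_cat.
Qed.

Lemma cell_cover_le (u : word) m (c : R) :
  (\int[mu]_(x in pcell K u) (`|f x - c| `^ p)%:E <=
  \sum_(t : m.-tuple 'I_5) \int[mu]_(x in pcell K (u ++ t)) (`|f x - c| `^ p)%:E)%E.
Proof.
have := @integral_cover _ _ _ mu (m.-tuple 'I_5) predT
  (fun t : m.-tuple 'I_5 => pcell K (u ++ t)) (pcell K u)
  (fun x => (`|f x - c| `^ p)%:E).
apply.
- by move=> t; exact: pcell_measurable.
- exact: measurable_powR_dist.
- by move=> x; rewrite lee_fin powR_ge0.
- by move=> x /(@pcell_cover _ _ _ m)[t tx]; exists t.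
Qed.

Lemma cell_integral_le (u : word) m (c b : R) :
  (forall t : m.-tuple 'I_5, `|average (u ++ t) - c| `^ p <= b) ->
  (\int[mu]_(x in pcell K u) (`|f x - c| `^ p)%:E <=
  (2 `^ p * (\sum_(t : m.-tuple 'I_5) oscillation (size u + m) (u ++ t) +
    b * 5 ^- size u))%:E)%E.
Proof.
move=> hb; apply: (le_trans (cell_cover_le u m c)).
apply: (@le_trans _ _ (\sum_(t : m.-tuple 'I_5)
    (2 `^ p * (oscillation (size u + m) (u ++ t) + b * 5 ^- (size u + m)))%:E)%E).
  apply: lee_sum => t _.
  apply: (le_trans (cell_powR_shift _ (average (u ++ t)) c)).
  rewrite [X in (_ <= X)%E]EFinM lee_wpmul2l ?lee_fin ?powR_ge0//.
  rewrite [X in (_ <= X)%E]EFinD leeD//.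
    apply: oscillation_adjacent; last exact: adjacent_refl.
    by rewrite size_cat size_tuple.
  rewrite lee_fin size_cat size_tuple.
  by rewrite ler_wpM2r// invr_ge0 exprn_ge0.
rewrite sumEFin lee_fin -mulr_sumr ler_wpM2l ?powR_ge0// big_split /= lerD2l.
rewrite sumr_const card_tuple card_ord -mulrnAr -mulr_natr natrX exprD invfM.
by rewrite mulfVK ?expf_neq0.
Qed.

(** Poincare inequality on a cell, with the energy read [m] levels below: all
    averages over the subcells are compared with the average over a corner
    subcell, which in turn replaces the average over [u]. *)
Lemma poincare_cell (u : word) m :
  (\int[mu]_(x in pcell K u) (`|f x - average u| `^ p)%:E <=
  (2 * (2 `^ p * (2 `^ p * 2)) * (5 ^+ m * (3 ^+ m) `^ (p - 1)) *
    \sum_(t : m.-tuple 'I_5) oscillation (size u + m) (u ++ t))%:E)%E.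
Proof.
set S := \sum_(t : _) _; pose c := average (u ++ nseq m ord0).
have S0 : 0 <= S by apply: sumr_ge0 => t _; exact: oscillation_ge0.
set B := 5 ^+ m * (3 ^+ m) `^ (p - 1).
have B1 : 1 <= B.
  rewrite -[1]mulr1 ler_pM// ?exprn_ege1 ?ler1n//.
  have := @ler_powR R (3 ^+ m) _ 0 (p - 1); rewrite powRr0; apply.
    by rewrite exprn_ege1 ?ler1n.
  by rewrite subr_ge0.
have h1 : (\int[mu]_(x in pcell K u) (`|f x - c| `^ p)%:E <=
    (2 `^ p * (2 * (B * S)))%:E)%E.
  have := @cell_integral_le u m c
    ((3 ^+ m) `^ (p - 1) * (5 ^+ (size u + m) * S)).
  move=> /(_ _) h; apply: (le_trans (h _)).
    by move=> t; rewrite distrC; apply: average_chain; rewrite size_tuple.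
  rewrite lee_fin ler_wpM2l ?powR_ge0//.
  have -> : (3 ^+ m) `^ (p - 1) * (5 ^+ (size u + m) * S) / 5 ^+ size u = B * S.
    by rewrite /B exprD; field; rewrite expf_neq0.
  have : S <= B * S by rewrite ler_peMl.
  by rewrite -/S; lra.
apply: (le_trans (cell_powR_shift u c (average u))).
have J := jensen_cell u c.
apply: (@le_trans _ _ ((2 `^ p)%:E *
    ((2 `^ p * (2 * (B * S)))%:E + (2 `^ p * (2 * (B * S)))%:E))%E).
  rewrite lee_wpmul2l ?lee_fin ?powR_ge0// leeD// distrC.
  exact: le_trans J h1.
rewrite -EFinD -EFinM lee_fin le_eqVlt; apply/orP; left; apply/eqP; ring.
Qed.

Lemma sum_oscillation_total k m :
  \sum_(u : k.-tuple 'I_5) \sum_(t : m.-tuple 'I_5) oscillation (size u + m) (u ++ t) =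
  \sum_(w : (k + m).-tuple 'I_5) oscillation (k + m) w.
Proof.
rewrite sum_tuple_cat; apply: eq_bigr => u _; apply: eq_bigr => t _.
by rewrite size_tuple.
Qed.

End CellOscillation.

(** * Lower bounds for the energy *)

Section EnergyLowerBound.
Variables (R : realType) (K : vicsekSet R).
Variable d : vicsekType K -> vicsekType K -> R.
Variable mu : {measure set (vicsekBorel K) -> \bar R}.
Hypothesis hd : geodesic_distance d.
Hypothesis hmu : normalized_measure mu.
Variables (p : R) (f : vicsekBorel K -> R).
Hypothesis p1 : 1 <= p.
Hypothesis fp : f \in Lfun mu p%:E.
Variable C : nat.
Hypothesis C0 : (0 < C)%N.
Hypothesis hC : forall n (z : 'rV[R]_2), (#|near_cells K n z| <= C)%N.
Let mf := Lfun_measurable fp.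
Local Notation average := (average mu f).
Local Notation oscillation := (oscillation mu p f).
Local Notation pcell := (pcell K).

Definition energy_integrand (alpha r : R) (x : vicsekBorel K) : \bar R :=
  ((mu (dball d x r))^-1 *
     \int[mu]_(y in dball d x r) (`|f y - f x| `^ p / r `^ (p * alpha))%:E)%E.

Lemma energy_integrand_ge0 alpha r x : (0 <= energy_integrand alpha r x)%E.
Proof.
rewrite /energy_integrand mule_ge0//.
  by rewrite inve_ge0.
by apply: integral_ge0 => y _; rewrite lee_fin divr_ge0// powR_ge0.
Qed.

(** Jensen's inequality on the cell [w']: it is contained in the ball of radius
    [r] about [x], and its share of the measure of this ball is at least
    1 / C. *)
Lemma energy_integrand_ge n (w w' : word) x (r alpha : R) :
  size w = n -> size w' = n -> adjacent R w w' -> pcell w x ->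
  9 * 3 ^- n <= r -> r < 27 * 3 ^- n ->
  ((`|f x - average w'| `^ p)%:E <=
    (C%:R * r `^ (p * alpha))%:E * energy_integrand alpha r x)%E.
Proof.
move=> sw sw' ww' wx r9 r27.
have n0 : (0 : R) < 3 ^- n by rewrite invr_gt0 exprn_gt0.
have r0 : 0 < r by apply: lt_le_trans r9; rewrite mulr_gt0.
have ra0 : 0 < r `^ (p * alpha) by rewrite powR_gt0.
have sub : pcell w' `<=` dball d x r.
  move=> y wy; rewrite /dball /=; apply: (le_lt_trans (distance_le hd sw sw' ww' wx wy)).
  by apply: lt_le_trans r9; rewrite ltr_pM2r// ltr_nat.
have mB := dball_measurable hd x r.
pose m := fine (mu (dball d x r)).
have mE : mu (dball d x r) = m%:E by rewrite fineK// (mu_dball_fin hd hmu).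
have m5 : 5 ^- n <= m.
  rewrite -lee_fin -mE -sw' -(mu_pcell hmu); apply: le_measure; rewrite ?inE//.
  exact: pcell_measurable.
have mC : m <= C%:R * 5 ^- n.
  by rewrite -lee_fin -mE; exact: mu_dball_le hC r27.
have n50 : (0 : R) < 5 ^- n by rewrite invr_gt0 exprn_gt0.
have m0 : 0 < m by exact: lt_le_trans m5.
rewrite /energy_integrand mE inver gt_eqF//.
under eq_integral do rewrite mulrC EFinM.
rewrite ge0_integralZl//; last 2 first.
- exact: measurable_powR_dist.
- by rewrite lee_fin invr_ge0 ltW.
have J := jensen_cell hmu p1 fp w' (f x).
have {}J : ((`|average w' - f x| `^ p * 5 ^- size w')%:E <=
    \int[mu]_(y in dball d x r) (`|f y - f x| `^ p)%:E)%E.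
  apply: le_trans J _; apply: ge0_subset_integral => //.
  - exact: pcell_measurable.
  - exact: measurable_powR_dist.
rewrite !muleA -!EFinM.
have -> : C%:R * r `^ (p * alpha) * m^-1 * (r `^ (p * alpha))^-1 = C%:R / m.
  by field; rewrite !gt_eqF.
apply: (@le_trans _ _ ((C%:R / m)%:E * (`|average w' - f x| `^ p * 5 ^- size w')%:E)%E).
  rewrite -EFinM lee_fin distrC mulrCA ler_peMr ?powR_ge0//.
  by rewrite mulrAC ler_pdivlMr// mul1r sw'.
by rewrite lee_wpmul2l// lee_fin divr_ge0// ltW.
Qed.

(** The pointwise bound on each pair of adjacent cells, summed over all pairs:
    a point belongs to boundedly many cells, each with boundedly many
    neighbours. *)
Lemma energy_ge_oscillation n (r alpha : R) :
  9 * 3 ^- n <= r -> r < 27 * 3 ^- n ->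
  ((\sum_(w : n.-tuple 'I_5) oscillation n w)%:E <=
    ((C * C)%:R * (C%:R * r `^ (p * alpha)))%:E * energy d mu p alpha f r)%E.
Proof.
move=> r9 r27.
have r0 : 0 < r by apply: lt_le_trans r9; rewrite mulr_gt0// invr_gt0 exprn_gt0.
pose I : finType := (n.-tuple 'I_5 * n.-tuple 'I_5)%type.
pose P (i : I) := `[< adjacent R i.1 i.2 >].
have -> : (\sum_(w : n.-tuple 'I_5) oscillation n w)%:E =
    (\sum_(i : I | P i) \int[mu]_(x in pcell i.1) (`|f x - average i.2| `^ p)%:E)%E.
  rewrite -(pair_big_dep predT (fun w w' => P (w, w')) (fun w w' =>
    \int[mu]_(x in pcell w) (`|f x - average w'| `^ p)%:E))%E /=.
  rewrite -sumEFin; apply: eq_bigr => w _; rewrite -sumEFin.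
  by apply: eq_bigr => w' _; rewrite fineK// (integral_powR_fin hmu p1 fp).
have -> : energy d mu p alpha f r =
    (\int[mu]_x energy_integrand alpha r x)%E by [].
apply: (@integral_multiplicity _ _ _ mu I P (fun i => pcell i.1)
  (fun i x => (`|f x - average i.2| `^ p)%:E) (energy_integrand alpha r)) => //.
- by move=> i; exact: pcell_measurable.
- by move=> i; exact: measurable_powR_dist.
- by move=> x; exact: energy_integrand_ge0.
- by rewrite muln_gt0 C0.
- by rewrite mulr_gt0 ?ltr0n ?powR_gt0.
- move=> [w w'] x /asboolP /= ww' wx.
  by apply: energy_integrand_ge wx r9 r27; rewrite ?size_tuple.
- move=> x; apply: (@leq_trans
    #|finset.setX (near_cells K n (vval x)) (near_cells K n (vval x))|).
    apply: subset_leq_card; apply/fintype.subsetP => -[w w']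
      /andP[/asboolP ww' /set_mem wx].
    rewrite finset.in_setX; apply/andP; split; first exact: near_cells_mem.
    exact: near_cells_adjacent wx ww'.
  by rewrite cardsX leq_mul.
Qed.

End EnergyLowerBound.

(** Multiplied by [p] this is p - 1 + d_h: the power of the scale that Holder's
    inequality costs along a chain, plus the one that gives the mass of a cell.
    It turns out to be the critical exponent. *)
Definition walk_exponent (R : realType) (p : R) : R :=
  1 + (hausdorff_dim R - 1) / p.

Section Scales.
Variable R : realType.
Local Notation dh := (hausdorff_dim R).

Lemma ln3_gt0 : 0 < ln 3 :> R.
Proof. by rewrite ln_gt0// ltr1n. Qed.

Lemma hausdorff_dim_gt1 : 1 < dh.
Proof. by rewrite /hausdorff_dim ltr_pdivlMr ?ln3_gt0// mul1r ltr_ln ?posrE// ltr_nat. Qed.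

Lemma powR_scale n (c : R) : (3 ^- n) `^ c = (3 `^ c) ^- n.
Proof.
have e (a : R) : 0 <= a -> a ^- n = a `^ (- n%:R) by move=> a0; rewrite powR_invn.
have [a3 b3] : 0 <= (3 : R) /\ 0 <= 3 `^ c :> R by rewrite ler0n powR_ge0.
by rewrite (e _ a3) (e _ b3) -[LHS]powRrM -[RHS]powRrM [c * _]mulrC.
Qed.

(** A cell of level [n] has diameter about 3 ^ - n and mass 5 ^ - n. *)
Lemma powR_scale_dim n : (3 ^- n) `^ dh = 5 ^- n :> R.
Proof.
rewrite powR_scale /powR gt_eqF//; congr (_ ^- _).
by rewrite /hausdorff_dim divfK ?gt_eqF ?ln3_gt0// lnK// posrE.
Qed.

Lemma walk_exponentE (p : R) : p != 0 -> p * walk_exponent p = (p - 1) + dh.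
Proof. by move=> p0; rewrite /walk_exponent; field. Qed.

Lemma scale_walk n (p : R) : 0 < p ->
  (3 ^- n) `^ (p * walk_exponent p) = (3 ^- n) `^ (p - 1) * 5 ^- n.
Proof.
move=> p0; rewrite walk_exponentE ?gt_eqF// powRD ?powR_scale_dim//.
by apply/implyP => _; rewrite gt_eqF// invr_gt0 exprn_gt0.
Qed.

Lemma scale_exists (r : R) : 0 < r -> r < 27 ->
  exists n, 9 * 3 ^- n <= r /\ r < 27 * 3 ^- n.
Proof.
move=> r0 r27; have [n0 h0] := @geometric_small R 9 r r0.
have ex : exists n, 9 * 3 ^- n <= r by exists n0; exact: ltW.
exists (ex_minn ex); case: ex_minnP => n hn nmin; split => //.
case: n hn nmin => [|n] hn nmin; first by rewrite expr0 invr1 mulr1.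
have := nmin n; rewrite ltnn => /contraFN /(_ erefl); rewrite -ltNge.
by move=> h; rewrite exprS invfM mulrA; lra.
Qed.

Lemma scale_level (r : R) n k : r < 9 * 3 ^- k -> 9 * 3 ^- n <= r -> (k <= n)%N.
Proof.
move=> rk rn; rewrite leqNgt; apply/negP => nk.
have := le_lt_trans rn rk; rewrite ltr_pM2l// ltf_pV2 ?posrE ?exprn_gt0//.
by rewrite ltr_eXn2l ?ltr1n// ltnNge ltnW.
Qed.

End Scales.

Section Poincare.
Variables (R : realType) (K : vicsekSet R).
Variable d : vicsekType K -> vicsekType K -> R.
Variable mu : {measure set (vicsekBorel K) -> \bar R}.
Hypothesis hd : geodesic_distance d.
Hypothesis hmu : normalized_measure mu.
Variable p : R.
Hypothesis p1 : 1 <= p.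
Let p0 : 0 < p. Proof. exact: lt_le_trans p1. Qed.

(** The previous bound, with the power of the scale at the walk exponent
    separated from the effect of the excess of [alpha] over this exponent. *)
Lemma total_oscillation : exists2 D : R, 0 < D &
  forall f (alpha r : R) n, f \in Lfun mu p%:E ->
    9 * 3 ^- n <= r -> r < 27 * 3 ^- n ->
  ((\sum_(w : n.-tuple 'I_5) oscillation mu p f n w)%:E <=
    (D * (3 ^- n) `^ (p * walk_exponent p) *
     r `^ (p * (alpha - walk_exponent p)))%:E * energy d mu p alpha f r)%E.
Proof.
have [C C0 hC] := card_near_cells_le K.
have pa0 : 0 <= p * walk_exponent p.
  rewrite walk_exponentE ?gt_eqF// addr_ge0 ?subr_ge0//.
  exact: ltW (lt_trans ltr01 (hausdorff_dim_gt1 R)).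
exists ((C * C)%:R * C%:R * 27 `^ (p * walk_exponent p)).
  by rewrite !mulr_gt0 ?powR_gt0 ?ltr0n// muln_gt0 C0.
move=> f alpha r n fp r9 r27.
have r0 : 0 < r by apply: lt_le_trans r9; rewrite mulr_gt0// invr_gt0 exprn_gt0.
apply: (le_trans (energy_ge_oscillation hd hmu p1 fp C0 hC alpha r9 r27)).
have E0 : (0 <= energy d mu p alpha f r)%E.
  by apply: integral_ge0 => x _; exact: energy_integrand_ge0.
rewrite lee_wpmul2r// lee_fin -mulrA -!mulrA !ler_wpM2l//.
rewrite mulrA -powRM// ?invr_ge0 ?exprn_ge0//.
have -> : p * alpha = p * walk_exponent p + p * (alpha - walk_exponent p) by ring.
rewrite powRD; last by apply/implyP => _; rewrite gt_eqF.
rewrite ler_wpM2r ?powR_ge0// ge0_ler_powR ?nnegrE ?(ltW r0) ?(ltW r27)//.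
Qed.

(** The radius [r] may be arbitrarily small compared with the cells of level
    [k]: at the walk exponent, the constants lost in the Poincare inequality
    from level [k] to the level of [r] are exactly those gained by the energy.
    This is why the lower limit of the energies controls the function. *)
Lemma poincare : exists2 D : R, 0 < D &
  forall f (alpha r : R) n k, f \in Lfun mu p%:E ->
    9 * 3 ^- n <= r -> r < 27 * 3 ^- n -> (k <= n)%N ->
  (\sum_(u : k.-tuple 'I_5)
     \int[mu]_(x in pcell K u) (`|f x - average mu f u| `^ p)%:E <=
   (D * (3 ^- k) `^ (p * walk_exponent p) *
     r `^ (p * (alpha - walk_exponent p)))%:E * energy d mu p alpha f r)%E.
Proof.
have [D D0 hD] := total_oscillation.
pose c : R := 2 * (2 `^ p * (2 `^ p * 2)).
have c0 : 0 < c by rewrite !mulr_gt0 ?powR_gt0.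
exists (c * D); first by rewrite mulr_gt0.
move=> f alpha r n k fp r9 r27 kn; pose m := (n - k)%N.
have nE : n = (k + m)%N by rewrite subnKC.
pose B : R := 5 ^+ m * (3 ^+ m) `^ (p - 1).
have B0 : 0 < B by rewrite mulr_gt0 ?exprn_gt0// powR_gt0 ?exprn_gt0.
apply: (@le_trans _ _ (c * B * \sum_(w : n.-tuple 'I_5) oscillation mu p f n w)%:E).
  rewrite nE -(sum_oscillation_total mu p f k m) mulr_sumr -sumEFin.
  by apply: lee_sum => u _; exact: (poincare_cell hmu p1 fp).
have := hD f alpha r n fp r9 r27.
move=> /(lee_wpmul2l (_ : 0 <= (c * B)%:E)%E); rewrite lee_fin => /(_ _) h.
rewrite EFinM; apply: (le_trans (h _)); first by rewrite mulr_ge0 ?ltW.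
rewrite muleA -EFinM.
have -> : c * B * (D * (3 ^- n) `^ (p * walk_exponent p) *
    r `^ (p * (alpha - walk_exponent p))) =
  c * D * (3 ^- k) `^ (p * walk_exponent p) * r `^ (p * (alpha - walk_exponent p)).
  rewrite !scale_walk// nE !exprD !invfM powRM ?invr_ge0 ?exprn_ge0//.
  have e : (3 ^+ m) `^ (p - 1) * (3 ^- m) `^ (p - 1) = 1 :> R.
    by rewrite -powRM ?invr_ge0 ?exprn_ge0// divff ?expf_neq0// powR1.
  have e5 : 5 ^+ m * 5 ^- m = 1 :> R by rewrite divff// expf_neq0.
  rewrite /B; move: e e5; set a := (_ `^ _); set b := (_ `^ _) => e e5.
  transitivity (a * b * (5 ^+ m * 5 ^- m) * (c * D *
    ((3 ^- k) `^ (p - 1) * 5 ^- k) * r `^ (p * (alpha - walk_exponent p)))).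
    by rewrite -!mulrA; ring.
  by rewrite e e5 !mul1r.
by [].
Qed.

End Poincare.

(** * Projection on a diagonal of the square *)

(** The projection of the Vicsek set onto its diagonal, in the coordinates [u]
    along the diagonal and [v] across it, is the fixed point of a contraction:
    it commutes with the maps of the three subcells on the diagonal, and sends
    the two subcells off the diagonal to the centre. *)
Section DiagonalProjection.
Variable R : realType.
Implicit Types u v : R.

Definition projection_step (g : R -> R -> R) u v : R :=
  if 3^-1 < u then 2 / 3 + g (3 * u - 2) (3 * v) / 3
  else if u < - 3^-1 then - (2 / 3) + g (3 * u + 2) (3 * v) / 3
  else if (3^-1 < v) || (v < - 3^-1) then 0
  else g (3 * u) (3 * v) / 3.

Definition projection_approx n : R -> R -> R := iter n projection_step (fun u _ => u).

Lemma projection_step_dist (g h : R -> R -> R) (e : R) :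
  (forall u v, `|g u v - h u v| <= e) ->
  forall u v, `|projection_step g u v - projection_step h u v| <= 3^-1 * e.
Proof.
move=> gh u v; have e0 : 0 <= e by exact: le_trans (gh 0 0).
have third (a b : R) : `|a - b| <= e -> `|a / 3 - b / 3| <= 3^-1 * e.
  by move=> ab; rewrite -mulrBl normrM (@ger0_norm _ 3^-1)// mulrC ler_pM2l.
have sub (c a b : R) : c + a - (c + b) = a - b by ring.
rewrite /projection_step; case: ifP => _; first by rewrite sub third.
case: ifP => _; first by rewrite sub third.
case: ifP => _; first by rewrite subrr normr0 mulr_ge0.
exact: third.
Qed.

Lemma projection_approx_cauchy n u v :
  `|projection_approx n.+1 u v - projection_approx n u v| <= 3^-1 * 3 ^- n.
Proof.
elim: n u v => [|n IH] u v; last first.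
  by rewrite exprS invfM; apply: projection_step_dist.
rewrite expr0 invr1 mulr1 /projection_approx /= /projection_step.
have [h1|h1] := ltP 3^-1 u; first by rewrite ler_norml; apply/andP; split; lra.
have [h2|h2] := ltP u (- 3^-1); first by rewrite ler_norml; apply/andP; split; lra.
by case: ifP => _; rewrite ler_norml; apply/andP; split; lra.
Qed.

(** Limit of the approximations: those at rank [n] err by at most 3 ^- n, so
    that subtracting 3 ^- n makes them nondecreasing. *)
Definition projection u v : R :=
  sup (range (fun n => projection_approx n u v - 3 ^- n)).

Lemma projection_approxP n u v : `|projection u v - projection_approx n u v| <= 3 ^- n.
Proof.
pose a n := projection_approx n u v.
have t0 n' : (0 : R) < 3 ^- n' by rewrite invr_gt0 exprn_gt0.
have ts n' : (3 ^- n'.+1 : R) = 3^-1 * 3 ^- n' by rewrite exprS invfM.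
have ca n' : `|a n'.+1 - a n'| <= 3^-1 * 3 ^- n' by exact: projection_approx_cauchy.
have lo : {homo (fun n => a n - 3 ^- n) : m n / (m <= n)%N >-> m <= n}.
  apply: homo_leq => [x|y x z|m]; [exact: lexx|exact: le_trans|].
  by have := ca m; have := t0 m; rewrite ts ler_norml; lra.
have hi : {homo (fun n => a n + 3 ^- n) : m n / (m <= n)%N >-> n <= m}.
  apply: homo_leq => [x|y x z xy yz|m]; [exact: lexx|exact: le_trans yz xy|].
  by have := ca m; have := t0 m; rewrite ts ler_norml; lra.
have ub m k : a m - 3 ^- m <= a k + 3 ^- k.
  have [mk|/ltnW km] := leqP m k.
    by apply: (le_trans (lo _ _ mk)); have := t0 k; lra.
  by apply: le_trans (hi _ _ km); have := t0 m; lra.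
have hs : has_sup (range (fun n => projection_approx n u v - 3 ^- n)).
  split; first by exists (a 0%N - 3 ^- 0); exists 0%N.
  by exists (a 0%N + 3 ^- 0) => _ [k _ <-]; exact: ub.
rewrite ler_distl; apply/andP; split.
  by apply: sup_upper_bound => //; exists n.
by apply: ge_sup => [|_ [k _ <-]]; [case: hs|exact: ub].
Qed.

Lemma projection_fixed u v : projection u v = projection_step projection u v.
Proof.
apply/eqP; rewrite -subr_eq0 -normr_le0; apply/ler_addgt0Pr => e e0.
have [n hn] := geometric_small 1 e0; rewrite add0r.
have h1 := projection_approxP n.+1 u v.
have h2 := projection_step_dist (projection_approxP n) u v.
have ts : (3 ^- n.+1 : R) = 3^-1 * 3 ^- n by rewrite exprS invfM.
have t0 : (0 : R) < 3 ^- n by rewrite invr_gt0 exprn_gt0.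
apply: (le_trans (ler_distD (projection_approx n.+1 u v) _ _)).
rewrite [X in _ + X]distrC {2}/projection_approx iterS -/(projection_approx n).
by move: h1 h2; rewrite ts; lra.
Qed.

Lemma projection_right : projection 1 0 = 1.
Proof.
have := projection_fixed 1 0; rewrite /projection_step ifT; last by lra.
rewrite mulr1 mulr0 (_ : 3 - 2 = 1); last by ring.
lra.
Qed.

Lemma projection_left : projection (-1) 0 = -1.
Proof.
have := projection_fixed (-1) 0; rewrite /projection_step ifF; last by lra.
rewrite ifT; last by lra.
rewrite mulr0 (_ : 3 * (-1) + 2 = -1); last by ring.
lra.
Qed.

Lemma projection_end (v : R) : `|v| = 1 -> projection 0 v = 0.
Proof.
move=> v1; rewrite projection_fixed /projection_step ifF; last by lra.
rewrite ifF; last by lra.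
rewrite ifT//; move: v1; case: (ler0P v) => _ h; apply/orP; [right|left]; lra.
Qed.

(** The contraction chooses a subcell by strict inequalities; the equations
    below hold on whole subcells, at the points shared by two of them as well. *)
Section Diamond.
Variables u v : R.
Hypothesis uv : `|u| + `|v| <= 1.

Let corner_v : `|u| = 1 -> v = 0.
Proof. by move=> u1; apply/eqP; rewrite -normr_le0; move: uv; lra. Qed.

Let diamond_facts : [/\ - v <= `|v|, v <= `|v|, - u <= `|u|, u <= `|u| &
  [/\ 0 <= `|v|, 0 <= `|u| & `|u| + `|v| <= 1]].
Proof.
by split; [rewrite -normrN ler_norm|exact: ler_norm|rewrite -normrN ler_norm|
  exact: ler_norm|split].
Qed.

Let inner (a b : R) : `|b| <= 1 -> a = b / 3 -> (3^-1 < a) || (a < - 3^-1) = false.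
Proof.
move=> b1 ->; have := ler_norm b; have := ler_norm (- b); rewrite normrN => ? ?.
by apply/negbTE; rewrite negb_or -!leNgt; apply/andP; split; lra.
Qed.

Lemma projection_centre_cell :
  projection (u / 3) (v / 3) = projection u v / 3.
Proof.
have [h1 h2 h3 h4 [h5 h6 h7]] := diamond_facts.
rewrite projection_fixed /projection_step ifF; last by lra.
rewrite ifF; last by lra.
rewrite (inner (b := v))//; last by lra.
by congr (projection _ _ / 3); field.
Qed.

Lemma projection_right_cell :
  projection ((u + 2) / 3) (v / 3) = 2 / 3 + projection u v / 3.
Proof.
have [h1 h2 h3 h4 [h5 h6 h7]] := diamond_facts.
have [u1|u1] := eqVneq u (-1).
  have v0 : v = 0 by apply: corner_v; rewrite u1 normrN normr1.
  rewrite u1 v0 mul0r projection_left projection_fixed /projection_step ifF; last by lra.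
  rewrite ifF; last by lra.
  rewrite (inner (b := 0)) ?normr0 ?mul0r//.
  rewrite mulr0 (_ : 3 * ((-1 + 2) / 3) = 1) ?projection_right; last by field.
  lra.
rewrite projection_fixed /projection_step ifT.
  by congr (_ + projection _ _ / 3); field.
have : -1 < u by rewrite lt_neqAle eq_sym u1; lra.
lra.
Qed.

Lemma projection_left_cell :
  projection ((u - 2) / 3) (v / 3) = - (2 / 3) + projection u v / 3.
Proof.
have [h1 h2 h3 h4 [h5 h6 h7]] := diamond_facts.
have [u1|u1] := eqVneq u 1.
  have v0 : v = 0 by apply: corner_v; rewrite u1 normr1.
  rewrite u1 v0 mul0r projection_right projection_fixed /projection_step ifF; last by lra.
  rewrite ifF; last by lra.
  rewrite (inner (b := 0)) ?normr0 ?mul0r//.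
  rewrite mulr0 (_ : 3 * ((1 - 2) / 3) = -1) ?projection_left; last by field.
  lra.
have {u1} : u < 1 by rewrite lt_neqAle u1; lra.
move=> u1; rewrite projection_fixed /projection_step ifF; last by lra.
rewrite ifT; last by lra.
by congr (_ + projection _ _ / 3); field.
Qed.

Lemma projection_side_cell (e : R) : `|e| = 1 ->
  projection (u / 3) ((v + 2 * e) / 3) = 0.
Proof.
move=> e1; have [h1 h2 h3 h4 [h5 h6 h7]] := diamond_facts.
have [ve|ve] := eqVneq v (- e).
  have u0 : u = 0 by apply/eqP; rewrite -normr_le0; move: uv; rewrite ve normrN; lra.
  have -> : (v + 2 * e) / 3 = e / 3 by rewrite ve; field.
  rewrite u0 mul0r projection_fixed /projection_step ifF; last by lra.
  rewrite ifF; last by lra.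
  rewrite (inner (b := e)) ?e1// mulr0 (_ : 3 * (e / 3) = e); last by field.
  by rewrite projection_end// mul0r.
rewrite projection_fixed /projection_step ifF; last by lra.
rewrite ifF; last by lra.
rewrite ifT//; apply/orP; move: e1 ve; case: (ler0P e) => _ e1 ve.
  have ee : e = -1 by lra.
  by right; have : v < 1; [rewrite lt_neqAle; move: ve; rewrite ee opprK => ->; lra|lra].
have ee : e = 1 by lra.
left; have : -1 < v; [rewrite lt_neqAle eq_sym; move: ve; rewrite ee => ->; lra|lra].
Qed.

End Diamond.
End DiagonalProjection.

(** * Projection of the Vicsek set on its diagonal *)

Section DiagonalFunction.
Variables (R : realType) (K : vicsekSet R).
Implicit Types (x y z : 'rV[R]_2) (i j : 'I_5) (w : word).

(** Coordinates along and across the diagonal through the corners 1 and 3,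
    normalized so that these corners lie at 1 and -1. *)
Definition along x : R := (x 0 0 + x 0 1) / (2 * half_side).
Definition across x : R := (x 0 0 - x 0 1) / (2 * half_side).

Definition along_digit i : int := [:: 0; 1; 0; -1; 0]`_i.
Definition across_digit i : int := [:: -1; 0; 1; 0; 0]`_i.

Lemma along_psi i x : along (psi i x) = (along x + 2 * (along_digit i)%:~R) / 3.
Proof.
have h0 := half_side_gt0 R; rewrite /along !psi_coord.
by case: i => -[|[|[|[|[|]]]]]//= ?; rewrite /digit /along_digit /=; field; rewrite gt_eqF.
Qed.

Lemma across_psi i x : across (psi i x) = (across x + 2 * (across_digit i)%:~R) / 3.
Proof.
have h0 := half_side_gt0 R; rewrite /across !psi_coord.
by case: i => -[|[|[|[|[|]]]]]//= ?; rewrite /digit /across_digit /=; field; rewrite gt_eqF.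
Qed.

Lemma diamond x : vicsek_carrier K x -> `|along x| + `|across x| <= 1.
Proof.
move=> /carrier_norm hx; have h0 := half_side_gt0 R.
have h00 := le_trans (coord_le_norm x 0) hx.
have h01 := le_trans (coord_le_norm x 1) hx.
rewrite /along /across !normrM !(@ger0_norm _ (_^-1)) ?invr_ge0 ?mulr_ge0 ?(ltW h0)//.
rewrite -mulrDl ler_pdivrMr ?mulr_gt0// mul1r.
move: h00 h01; rewrite !ler_norml => /andP[? ?] /andP[? ?].
case: (ler0P (x 0 0 + x 0 1)) => ?; case: (ler0P (x 0 0 - x 0 1)) => ?; lra.
Qed.

Lemma coordinates_lipschitz x y :
  `|along x - along y| + `|across x - across y| <= 4 * `|x - y|.
Proof.
have h0 := half_side_gt R.
have c k : `|x 0 k - y 0 k| <= `|x - y|.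
  by have := coord_le_norm (x - y) k; rewrite !mxE.
have bound (a b : R) : `|a| <= `|x - y| -> `|b| <= `|x - y| ->
    `|(a + b) / (2 * half_side)| <= 2 * `|x - y|.
  move=> ha hb; rewrite normrM (@ger0_norm _ (_^-1)) ?invr_ge0; last by lra.
  rewrite ler_pdivrMr; last by lra.
  apply: (le_trans (ler_normD _ _)); have := normr_ge0 (x - y); nra.
rewrite /along /across -!mulrBl.
rewrite (_ : x 0 0 + x 0 1 - (y 0 0 + y 0 1) = (x 0 0 - y 0 0) + (x 0 1 - y 0 1)); last by ring.
rewrite (_ : x 0 0 - x 0 1 - (y 0 0 - y 0 1) = (x 0 0 - y 0 0) + - (x 0 1 - y 0 1)); last by ring.
rewrite (_ : 4 * _ = 2 * `|x - y| + 2 * `|x - y|); last by ring.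
by apply: lerD; apply: bound; rewrite ?normrN.
Qed.

Definition diagonal_function x : R := projection (along x) (across x).
Local Notation Phi := diagonal_function.

Lemma diagonal_function_psi i x : vicsek_carrier K x ->
  Phi (psi i x) = if across_digit i == 0 then (Phi x + 2 * (along_digit i)%:~R) / 3 else 0.
Proof.
move=> /diamond uv; rewrite /Phi along_psi across_psi.
case: i => -[|[|[|[|[|]]]]]//= ?; rewrite /along_digit /across_digit /=.
- by rewrite mulr0 addr0 projection_side_cell// normrN1.
- by rewrite mulr1 mulr0 addr0 projection_right_cell//; field.
- by rewrite mulr0 addr0 projection_side_cell// normr1.
- rewrite (_ : _ + 2 * -1 = along x - 2); last by ring.
  by rewrite mulr0 addr0 projection_left_cell//; field.
- by rewrite !mulr0 !addr0 projection_centre_cell.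
Qed.

Lemma carrier_psi x : vicsek_carrier K x ->
  exists i y, vicsek_carrier K y /\ x = psi i y.
Proof. by rewrite {1}(vicsek_selfsimilar K) => -[i _ [y Ky <-]]; exists i, y. Qed.

Lemma digit_cases2 i : [\/ [/\ along_digit i = 0 & across_digit i = -1],
  [/\ along_digit i = 1 & across_digit i = 0], [/\ along_digit i = 0 & across_digit i = 1]
  | [/\ along_digit i = -1 & across_digit i = 0] \/
    [/\ along_digit i = 0 & across_digit i = 0]].
Proof.
by case: i => -[|[|[|[|[|]]]]]//= ?;
 [constructor 1|constructor 2|constructor 3|constructor 4; left|constructor 4; right].
Qed.

(** The branch through [x] leaves the diagonal at the abscissa [Phi x] and
    stays in the two cones of slope one with apex at that point. *)
Lemma diagonal_function_cone x : vicsek_carrier K x -> `|Phi x - along x| <= `|across x|.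
Proof.
move=> Kx; apply/ler_addgt0Pr => e e0; have [n hn] := geometric_small 1 e0.
apply: (@le_trans _ _ (`|across x| + 1 * 3 ^- n)); last by rewrite lerD2l ltW.
elim: n x Kx {hn} => [|n IH] x Kx.
  rewrite expr0 invr1 mulr1.
  have := projection_approxP 0 (along x) (across x).
  by rewrite expr0 invr1 /= => h; apply: (le_trans h); rewrite lerDr.
have [i [y [Ky ->]]] := carrier_psi Kx.
rewrite diagonal_function_psi// along_psi across_psi exprS invfM mul1r.
have t0 : (0 : R) < 3 ^- n by rewrite invr_gt0 exprn_gt0.
have := IH y Ky; have := diamond Ky; rewrite mul1r.
set u := along y; set v := across y; set t := 3 ^- n in t0 *.
have third (a : R) : `|a / 3| = `|a| / 3 by rewrite normrM (@ger0_norm _ 3^-1).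
have cancel (a b c : R) : (a + c) / 3 - (b + c) / 3 = (a - b) / 3 by ring.
move=> uv h; have [] := digit_cases2 i => [[-> ->]|[-> ->]|[-> ->]|[[-> ->]|[-> ->]]] /=.
- rewrite mulr0 addr0 sub0r normrN !third; have := ler_norm (- (v + 2 * -1)).
  by have := ler_norm v; have := normr_ge0 u; rewrite normrN; lra.
- by rewrite mulr0 addr0 cancel !third; lra.
- rewrite mulr0 addr0 sub0r normrN !third; have := ler_norm (v + 2 * 1).
  by have := ler_norm (- v); have := normr_ge0 u; rewrite normrN; lra.
- by rewrite mulr0 addr0 cancel !third; lra.
- by rewrite !mulr0 !addr0 -mulrBl !third; lra.
Qed.

Lemma diagonal_function_le1 x : vicsek_carrier K x -> `|Phi x| <= 1.
Proof.
move=> Kx; have := diagonal_function_cone Kx; have := diamond Kx.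
have := ler_normD (Phi x - along x) (along x); rewrite subrK; lra.
Qed.

(** Branches that are higher than a third are attached at the centre. *)
Lemma diagonal_function_support x : vicsek_carrier K x ->
  Phi x = 0 \/ `|across x| <= 3^-1.
Proof.
move=> /carrier_psi[i [y [Ky ->]]]; rewrite diagonal_function_psi// across_psi.
case: eqVneq => [->|_]; last by left.
right; rewrite mulr0 addr0 normrM (@ger0_norm _ 3^-1)//.
by have := diamond Ky; have := normr_ge0 (along y); lra.
Qed.

(** The sum norm is the one for which subcells are contained in unit diamonds. *)
Definition dist x y : R := `|along x - along y| + `|across x - across y|.

(** Subcells on the diagonal lie in diamonds of the form |u| + |v| <= 1,
    centred on the diagonal, at the abscissas 2 * a and 2 * a' once scaled by 3.
    From a point of one diamond to the other, the distance along the diagonal is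
    at least the distance to the diagonal. *)
Lemma compare_axis_axis (u v P u' v' P' a a' : R) :
  `|u| + `|v| <= 1 -> `|P - u| <= `|v| -> `|u'| + `|v'| <= 1 -> `|P' - u'| <= `|v'| ->
  1 <= `|a - a'| ->
  `|P + 2 * a - (P' + 2 * a')| <= 2 * `|u + 2 * a - (u' + 2 * a')| /\
  `|v| <= `|u + 2 * a - (u' + 2 * a')|.
Proof.
move=> h1 h2 h3 h4.
have := ler_norm u; have := ler_norm (- u); have := ler_norm u'; have := ler_norm (- u').
rewrite !normrN => k1 k2 k3 k4; move: h2 h4; rewrite !ler_norml => /andP[? ?] /andP[? ?].
have := normr_ge0 v; have := normr_ge0 v'; set D := `|u + _ - _|.
have := ler_norm (u + 2 * a - (u' + 2 * a')).
have := ler_norm (- (u + 2 * a - (u' + 2 * a'))); rewrite normrN -/D => d1 d2.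
have := ler_norm v; have := ler_norm (- v); rewrite normrN.
by case: (ler0P (a - a')) => ? *; split; apply/andP; split; lra.
Qed.

(** A point of a subcell on the diagonal and one of a subcell off it: either
    the former belongs to a branch attached at the centre, where the latter is
    projected, or the two points are at distance bounded below. *)
Lemma compare_axis_side (u v P u' v' a b : R) :
  `|u| + `|v| <= 1 -> `|P - u| <= `|v| -> P = 0 \/ `|v| <= 3^-1 ->
  `|u'| + `|v'| <= 1 -> a = 0 \/ `|a| = 1 -> `|b| = 1 ->
  P + 2 * a = 0 \/
  (let D := `|u + 2 * a - u'| + `|v - (v' + 2 * b)| in
   [/\ `|P + 2 * a| <= 3 * D, `|v| <= 5 * D & `|v' + 2 * b| <= 5 * D]).
Proof.
move=> h1 h2 h3 h4 h5 h6 /=.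
have := ler_norm u; have := ler_norm (- u); have := ler_norm u'; have := ler_norm (- u').
have := ler_norm v; have := ler_norm (- v); have := ler_norm v'; have := ler_norm (- v').
rewrite !normrN => ? ? ? ? ? ? ? ?.
have ? := normr_ge0 u; have ? := normr_ge0 u'; have ? := normr_ge0 v; have ? := normr_ge0 v'.
have hP : `|P| <= 1 by have := ler_normD (P - u) u; rewrite subrK; lra.
have hPa : `|P + 2 * a| <= 1 + 2 * `|a|.
  by apply: (le_trans (ler_normD _ _)); rewrite normrM (@ger0_norm _ 2)//; lra.
have hb : `|v' + 2 * b| <= 3.
  by apply: (le_trans (ler_normD _ _)); rewrite normrM (@ger0_norm _ 2)// h6; lra.
set A := `|u + _ - _|; set B := `|v - _|.
have A0 : 0 <= A by exact: normr_ge0.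
have := ler_norm (u + 2 * a - u'); have := ler_norm (- (u + 2 * a - u')).
have := ler_norm (v - (v' + 2 * b)); have := ler_norm (- (v - (v' + 2 * b))).
rewrite !normrN -/A -/B => ? ? ? ?.
case: h5 => [a0|a1].
  case: h3 => [->|v3]; first by left; rewrite a0 mulr0 addr0.
  have AB : 2 / 3 <= A + B by move: h6; case: (ler0P b) => _ ?; lra.
  by right; move: hPa; rewrite a0 normr0 => ?; split; lra.
have AB : 2 <= A + B.
  by move: a1 h6; case: (ler0P a) => _ ?; case: (ler0P b) => _ ?; lra.
by right; move: hPa; rewrite a1 => ?; split; lra.
Qed.

Lemma dist_psi i j x y : dist (psi i x) (psi j y) =
  (`|along x + 2 * (along_digit i)%:~R - (along y + 2 * (along_digit j)%:~R)| +
   `|across x + 2 * (across_digit i)%:~R - (across y + 2 * (across_digit j)%:~R)|) / 3.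
Proof.
rewrite /dist !along_psi !across_psi -!mulrBl !normrM !(@ger0_norm _ 3^-1)//.
by rewrite [RHS]mulrDl.
Qed.

Lemma along_digit01 i : (along_digit i)%:~R = 0 :> R \/ `|(along_digit i)%:~R| = 1 :> R.
Proof.
by case: (digit_cases2 i) => [[-> _]|[-> _]|[-> _]|[[-> _]|[-> _]]];
 [left|right|left|right|left]; rewrite ?mulrN1z ?normrN ?normr1.
Qed.

Lemma across_digit1 i : across_digit i != 0 ->
  along_digit i = 0 /\ `|(across_digit i)%:~R| = 1 :> R.
Proof.
by case: (digit_cases2 i) => [[-> ->]|[_ ->]|[-> ->]|[[_ ->]|[_ ->]]];
 rewrite ?mulrN1z ?normrN ?normr1.
Qed.

Lemma along_digit_inj i j : i != j -> across_digit i = 0 -> across_digit j = 0 ->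
  1 <= `|(along_digit i)%:~R - (along_digit j)%:~R| :> R.
Proof.
move=> ij hi hj; rewrite -intrB -intr_norm -[1]/(1%:~R) ler_int.
suff : along_digit i != along_digit j by lia.
move: ij hi hj; case: i => -[|[|[|[|[|]]]]]//= ?; case: j => -[|[|[|[|[|]]]]]//= ?.
Qed.

(** The error term [c] makes the comparison trivial at rank 0 of the induction
    on the number of subdivisions, and disappears in the limit. *)
Definition comparable_at (c : R) x y :=
  `|Phi x - Phi y| <= 3 * dist x y + 2 * c /\
  (Phi x = Phi y \/ `|across x| <= 5 * dist x y + c).

Lemma compare_subcells i j x y : vicsek_carrier K x -> vicsek_carrier K y -> i != j ->
  `|Phi (psi i x) - Phi (psi j y)| <= 3 * dist (psi i x) (psi j y) /\
  (Phi (psi i x) = Phi (psi j y) \/ `|across (psi i x)| <= 5 * dist (psi i x) (psi j y)).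
Proof.
move=> Kx Ky ij; rewrite dist_psi !diagonal_function_psi// across_psi.
have third (a : R) : `|a / 3| = `|a| / 3 by rewrite normrM (@ger0_norm _ 3^-1).
case: eqVneq => [hi|/across_digit1[hi hi']]; case: eqVneq => [hj|/across_digit1[hj hj']].
- have [] := compare_axis_axis (diamond Kx) (diagonal_function_cone Kx) (diamond Ky)
    (diagonal_function_cone Ky) (along_digit_inj ij hi hj).
  rewrite -mulrBl hi hj !mulr0 !addr0 !third; set D := `|along x + _ - _| => h1 h2.
  have := normr_ge0 (across x - across y); have : 0 <= D by exact: normr_ge0.
  by move=> ? ?; split; [lra|right; lra].
- rewrite hi hj !mulr0 !addr0 subr0 !third.
  have := compare_axis_side (diamond Kx) (diagonal_function_cone Kx)
    (diagonal_function_support Kx) (diamond Ky) (along_digit01 i) hj'.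
  case=> [-> | [h1 h2 h3]]; last by split; [lra|right; lra].
  by rewrite !mul0r normr0; split; [rewrite !mul0r !mulr_ge0// addr_ge0|left].
- rewrite hi hj !mulr0 !addr0 sub0r normrN !third.
  have := compare_axis_side (diamond Ky) (diagonal_function_cone Ky)
    (diagonal_function_support Ky) (diamond Kx) (along_digit01 j) hi'.
  rewrite [`|_ - along x|]distrC [`|across y - _|]distrC.
  case=> [-> | [h1 h2 h3]]; last by split; [lra|right; lra].
  by rewrite !mul0r normr0; split; [rewrite !mul0r !mulr_ge0// addr_ge0|left].
- by rewrite subrr normr0; split; [rewrite !mulr_ge0// addr_ge0|left].
Qed.

(** Two points separate into different subcells of some common cell, and the
    comparison is invariant under scaling. *)
Lemma compare_points n x y : vicsek_carrier K x -> vicsek_carrier K y ->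
  comparable_at (3 ^- n) x y.
Proof.
elim: n x y => [|n IH] x y Kx Ky.
  have d0 : 0 <= dist x y by rewrite addr_ge0.
  rewrite /comparable_at expr0 invr1 mulr1; split; last first.
    by right; have := diamond Kx; have := normr_ge0 (along x); lra.
  apply: (le_trans (ler_normB _ _)).
  by have := diagonal_function_le1 Kx; have := diagonal_function_le1 Ky; lra.
have [i [x' [Kx' ->]]] := carrier_psi Kx; have [j [y' [Ky' ->]]] := carrier_psi Ky.
have t0 : (0 : R) < 3 ^- n by rewrite invr_gt0 exprn_gt0.
have [<-{j}|ij] := eqVneq i j; last first.
  have [h1 h2] := compare_subcells Kx' Ky' ij.
  have t1 : (0 : R) < 3 ^- n.+1 by rewrite invr_gt0 exprn_gt0.
  by split; [lra|case: h2 => ?; [left|right; lra]].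
have third (a : R) : `|a / 3| = `|a| / 3 by rewrite normrM (@ger0_norm _ 3^-1).
have cancel (a b c : R) : a + c - (b + c) = a - b by ring.
have [h1 h2] := IH _ _ Kx' Ky'; rewrite /comparable_at dist_psi !cancel -/(dist _ _).
rewrite !diagonal_function_psi// exprS invfM.
have d0 : 0 <= dist x' y' by rewrite addr_ge0.
case: eqVneq => [hi|_]; last first.
  by rewrite subrr normr0; split; [lra|left].
rewrite -mulrBl cancel across_psi hi mulr0 addr0 !third; split; first by lra.
by case: h2 => [->|h2]; [left|right; lra].
Qed.

Lemma diagonal_function_lipschitz x y : vicsek_carrier K x -> vicsek_carrier K y ->
  `|Phi x - Phi y| <= 12 * `|x - y|.
Proof.
move=> Kx Ky; apply/ler_addgt0Pr => e e0; have [n hn] := geometric_small 2 e0.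
have [h _] := compare_points n Kx Ky; have := coordinates_lipschitz x y.
by rewrite -/(dist x y); lra.
Qed.

(** Away from the diagonal the function is locally constant, so only a tube
    around the diagonal contributes to its energy. *)
Lemma diagonal_function_const x y : vicsek_carrier K x -> vicsek_carrier K y ->
  Phi x != Phi y -> `|across x| <= 20 * `|x - y|.
Proof.
move=> Kx Ky /eqP xy; apply/ler_addgt0Pr => e e0; have [n hn] := geometric_small 1 e0.
have [_ []//] := compare_points n Kx Ky; have := coordinates_lipschitz x y.
by rewrite -/(dist x y); lra.
Qed.

End DiagonalFunction.

(** * Energy of the projection on the diagonal *)

Section DiagonalCells.
Variables (R : realType) (K : vicsekSet R).
Implicit Types (w : word).

Lemma across_digit_le1 i : `|across_digit i| <= 1.
Proof. by case: i => -[|[|[|[|[|]]]]]. Qed.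

Lemma across_psi_word0 w : across (psi_word w (0 : 'rV[R]_2)) =
  2 * 3 ^- size w * (ternary across_digit w)%:~R.
Proof.
elim: w => [|i w IH] /=; first by rewrite /across !mxE subrr mul0r mulr0.
rewrite across_psi IH intrD intrM rmorphXn /= exprS.
by field; rewrite expf_neq0.
Qed.

(** Tells apart the three subcells on the diagonal, whose [across_digit] is 0. *)
Definition lane (i : 'I_5) : 'I_3 :=
  if i == inord 3 then inord 1 else if i == ord_max then inord 2 else ord0.

Lemma lane_inj i j : across_digit i = across_digit j -> lane i = lane j -> i = j.
Proof.
rewrite /lane -!val_eqE /= !inordK// => h /(congr1 val); move: h.
by case: i => -[|[|[|[|[|]]]]]//= ?; case: j => -[|[|[|[|[|]]]]]//= ?;
  rewrite /= ?inordK//= => _ _; exact: val_inj.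
Qed.

(** Few cells meet a neighbourhood of the diagonal: three choices of subcell
    at each level once the position across the diagonal is known. *)
Lemma card_diagonal_cells n (M : nat) :
  (#|[pred w : n.-tuple 'I_5 |
      (`|across (psi_word w (0 : 'rV[R]_2))| <= 2 * M%:R * 3 ^- n)%R]|
    <= (2 * M).+1 * 3 ^ n)%N.
Proof.
set P := [pred _ | _].
pose g (w : n.-tuple 'I_5) : 'I_(2 * M).+1 * n.-tuple 'I_3 :=
  (window M 0 (ternary across_digit w), map_tuple lane w).
have small (w : n.-tuple 'I_5) : P w -> `|ternary across_digit w - 0| <= M%:Z.
  rewrite /P /= across_psi_word0 size_tuple normrM (@ger0_norm _ (2 * _)) ?mulr_ge0//.
  rewrite mulrAC ler_pM2r ?invr_gt0 ?exprn_gt0// ler_pM2l// -intr_norm.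
  by rewrite subr0 -(ler_int R).
have ginj : {in P &, injective g}.
  move=> w w' Pw Pw' [e0 e1]; apply: val_inj.
  have sww : size w = size w' by rewrite !size_tuple.
  have m : map across_digit w = map across_digit w'.
    apply: ternary_inj sww _; first exact: across_digit_le1.
    by apply: window_inj e0; apply: small.
  apply: (@eq_from_nth _ 0) => // l lw; apply: lane_inj.
    by have := congr1 (nth 0 ^~ l) m; rewrite !(nth_map 0)// -sww.
  by have := congr1 (nth ord0 ^~ l) e1; rewrite !(nth_map 0)// -sww.
rewrite -(card_in_imset ginj) (leq_trans (max_card _))//.
by rewrite card_prod card_ord card_tuple card_ord.
Qed.

End DiagonalCells.

Section CriticalExponentLower.
Variables (R : realType) (K : vicsekSet R).
Variable d : vicsekType K -> vicsekType K -> R.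
Variable mu : {measure set (vicsekBorel K) -> \bar R}.
Hypothesis hd : geodesic_distance d.
Hypothesis hmu : normalized_measure mu.
Variable p : R.
Hypothesis p1 : 1 <= p.
Let p0 : 0 < p. Proof. exact: lt_le_trans p1. Qed.

Definition diagonal_map (x : vicsekBorel K) : R := diagonal_function (vval x).
Local Notation phi := diagonal_map.

Lemma diagonal_map_continuous : continuous (phi : vicsekType K -> R).
Proof.
move=> x; have FF : Filter (nbhs x) by exact: nbhs_filter.
apply/cvgrPdist_lt => e e0.
have near_x := vval_continuous (nbhsx_ballx (vval x) (e / 12) (divr_gt0 e0 (ltr0n _ 12))).
apply: (@filterS _ (nbhs x) FF _ _ _ near_x) => y; rewrite /= -ball_normE /= => xy.
apply: (le_lt_trans (diagonal_function_lipschitz (vvalP x) (vvalP y))).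
by rewrite mulrC -ltr_pdivlMr.
Qed.

Lemma diagonal_map_measurable : measurable_fun setT phi.
Proof.
move=> mT; apply: (measurability _ (RGenOInfty.measurableE R)) => //.
move=> _ [_ [a ->] <-]; rewrite setTI; apply: open_measurable_vicsek.
rewrite (_ : `]a, +oo[%classic = [set t | a < t]); last first.
  by apply/seteqP; split => t; rewrite /= in_itv /= andbT.
have := proj1 (continuousP _) diagonal_map_continuous _ (@open_gt R a).
by congr open.
Qed.

Lemma diagonal_map_Lfun : phi \in Lfun mu p%:E.
Proof.
rewrite inE; apply/andP; split; rewrite inE /=; first exact: diagonal_map_measurable.
rewrite /finite_norm unlock /Lnorm poweR_lty//.
apply: (@le_lt_trans _ _ (\int[mu]_x cst 1 x)%E).
  apply: ge0_le_integral_any => x _; first by rewrite lee_fin powR_ge0.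
  rewrite lee_fin (_ : 1 = 1 `^ p); last by rewrite powR1.
  rewrite ge0_ler_powR ?nnegrE ?(ltW p0)//.
  exact: diagonal_function_le1 (vvalP x).
by rewrite integral_cst// mul1e (mu_setT hmu) ltry.
Qed.

Lemma ae_meets (A : set (vicsekBorel K)) (P : vicsekBorel K -> Prop) :
  measurable A -> (0 < mu A)%E -> {ae mu, forall x, P x} -> exists2 x, A x & P x.
Proof.
move=> mA A0 nP; apply: contrapT => h.
have : mu.-negligible A.
  by apply: negligibleS nP => x Ax Px; apply: h; exists x.
by move=> /(measure_negligible mA) A00; rewrite A00 ltxx in A0.
Qed.

Lemma mu_pcell_gt0 w : (0 < mu (pcell K w))%E.
Proof. by rewrite (mu_pcell hmu) lte_fin invr_gt0 exprn_gt0. Qed.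

(** It vanishes on the corner cell 2, off the diagonal, and is at least 1 / 3
    on the corner cell 1. *)
Lemma diagonal_map_nonconstant : ~ ae_constant mu phi.
Proof.
move=> [c hc].
have [x [y Ky xy] xc] := ae_meets (pcell_measurable (K := K) [:: inord 1]) (mu_pcell_gt0 _) hc.
have [x' [y' Ky' xy'] xc'] := ae_meets (pcell_measurable (K := K) [:: inord 2]) (mu_pcell_gt0 _) hc.
have v1 : val (inord 1 : 'I_5) = 1%N by rewrite /= inordK.
have v2 : val (inord 2 : 'I_5) = 2%N by rewrite /= inordK.
have : c = 0.
  by rewrite -xc' /phi -xy' /= (diagonal_function_psi _ Ky') /across_digit v2.
rewrite -xc /phi -xy /= (diagonal_function_psi _ Ky) /across_digit /along_digit v1 /=.
by have := diagonal_function_le1 Ky; rewrite ler_norml => /andP[]; lra.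
Qed.

(** The function is 12-Lipschitz, and constant on the ball of radius [r] about
    [x] as soon as |across x| is larger than 20 * r. *)
Lemma diagonal_integrand_le (alpha r : R) x : 0 < r ->
  (energy_integrand d mu p phi alpha r x <=
    (if `|across (vval x)| <= 20 * r then (12 * r) `^ p / r `^ (p * alpha) else 0)%:E)%E.
Proof.
move=> r0; set c := (X in X%:E).
have c0 : 0 <= c by rewrite /c; case: ifP => // _; rewrite divr_ge0 ?powR_ge0.
have mB := dball_measurable hd x r.
have inner : (\int[mu]_(y in dball d x r) (`|phi y - phi x| `^ p / r `^ (p * alpha))%:E
    <= c%:E * mu (dball d x r))%E.
  rewrite -integral_cst//; apply: ge0_le_integral_any => y xy.
    by rewrite lee_fin divr_ge0 ?powR_ge0.
  have yx : `|vval y - vval x| <= r.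
    by rewrite distrC; apply: le_trans (distance_ge hd x y) (ltW _).
  rewrite lee_fin /c; case: ifPn => [_|].
    rewrite ler_wpM2r ?invr_ge0 ?powR_ge0// ge0_ler_powR ?nnegrE ?(ltW p0)//.
      by rewrite mulr_ge0// ltW.
    apply: (le_trans (diagonal_function_lipschitz (vvalP y) (vvalP x))).
    by rewrite ler_pM2l.
  rewrite -ltNge => far; have -> : phi y = phi x.
    apply: contrapT => /eqP; rewrite eq_sym.
    move=> /(diagonal_function_const (vvalP x) (vvalP y)).
    by rewrite distrC => ?; move: far; lra.
  by rewrite subrr normr0 powR0 ?mul0r// gt_eqF.
rewrite /energy_integrand; pose m := fine (mu (dball d x r)).
have mE : mu (dball d x r) = m%:E by rewrite fineK// (mu_dball_fin hd hmu).
have m0 : 0 <= m by rewrite -lee_fin -mE.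
apply: (@le_trans _ _ ((mu (dball d x r))^-1 * (c%:E * mu (dball d x r)))%E).
  by rewrite lee_wpmul2l// inve_ge0.
rewrite mE; have [->|mN0] := eqVneq m 0; first by rewrite !mule0.
by rewrite inver (negbTE mN0) -!EFinM lee_fin mulrCA mulVf// mulr1.
Qed.

(** Only the points at distance at most 20 * r from the diagonal contribute.
    They are covered by about 3 ^ n of the 5 ^ n cells of level [n], of total
    mass about r ^ (d_h - 1), while the integrand is at most a multiple of
    r ^ (p - p * alpha) = r ^ (1 - d_h). *)
Lemma energy_diagonal_bounded : exists M : R, forall r, 0 < r ->
  (energy d mu p (walk_exponent p) phi r <= M%:E)%E.
Proof.
(* 2 * 274 = 8 + 20 * 27: see the bound on cell centres below *)
exists (12 `^ p * (2 * 274).+1%:R) => r r0.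
set alpha := walk_exponent p.
have dh1 := hausdorff_dim_gt1 R; set dh := hausdorff_dim R in dh1 *.
have cE : (12 * r) `^ p / r `^ (p * alpha) = 12 `^ p / r `^ (dh - 1).
  rewrite powRM ?(ltW r0)// walk_exponentE ?gt_eqF//.
  rewrite (_ : p - 1 + hausdorff_dim R = p + (dh - 1)); last by rewrite /dh; ring.
  rewrite (powRD (r := p)); last by apply/implyP => _; rewrite gt_eqF.
  by field; rewrite !gt_eqF ?powR_gt0.
have -> : energy d mu p alpha phi r =
  (\int[mu]_x energy_integrand d mu p phi alpha r x)%E by [].
have [r27|r27] := ltP r 27; last first.
  apply: (@le_trans _ _ (\int[mu]_x cst (12 `^ p)%:E x)%E).
    apply: ge0_le_integral_any => x _; first exact: energy_integrand_ge0.
    apply: (le_trans (diagonal_integrand_le alpha x r0)); rewrite lee_fin.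
    case: ifP => _; last exact: powR_ge0.
    rewrite cE ler_pdivrMr ?powR_gt0// ler_peMr ?powR_ge0//.
    have := @ler_powR R r _ 0 (dh - 1); rewrite powRr0; apply; lra.
  rewrite integral_cst// (mu_setT hmu) mule1 lee_fin ler_peMr ?powR_ge0//.
  by rewrite ler1n.
have [n [r9 r27n]] := scale_exists r0 r27.
have n0 : (0 : R) < 3 ^- n by rewrite invr_gt0 exprn_gt0.
have n50 : (0 : R) < 5 ^- n by rewrite invr_gt0 exprn_gt0.
pose S (w : n.-tuple 'I_5) :=
  `|across (psi_word w (0 : 'rV[R]_2))| <= 2 * 274%:R * 3 ^- n.
set c : R := (12 * r) `^ p / r `^ (p * alpha).
have c0 : 0 <= c by rewrite divr_ge0 ?powR_ge0.
apply: (@le_trans _ _ (\sum_(w : n.-tuple 'I_5 | S w) \int[mu]_(x in pcell K w) cst c%:E x)%E).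
  rewrite (@integral_sum_cells _ _ _ mu _ S (fun w : n.-tuple 'I_5 => pcell K w)
    (fun _ => cst c%:E))//; last by move=> w; exact: pcell_measurable.
  apply: ge0_le_integral_any => x _; first exact: energy_integrand_ge0.
  apply: (le_trans (diagonal_integrand_le alpha x r0)); rewrite -/c.
  have t0 (w : n.-tuple 'I_5) : (0 <= (cst c%:E \_ (pcell K w)) x)%E.
    by rewrite /patch; case: ifP => // _; rewrite lee_fin.
  case: ifP => near_diag; last by apply: sume_ge0 => w _; exact: t0.
  have [w wx] : exists t : n.-tuple 'I_5, pcell K ([::] ++ t) x.
    by apply: pcell_cover; rewrite pcell_nil.
  have Sw : S w.
    have := cell_diam (cell_centre K w) wx; rewrite size_tuple => h1.
    have := coordinates_lipschitz (psi_word w 0) (vval x).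
    have := ler_normD (across (psi_word w 0) - across (vval x)) (across (vval x)).
    rewrite subrK /S; have := normr_ge0 (along (psi_word w 0) - along (vval x)).
    by move: near_diag; lra.
  rewrite (bigD1 w)//= {1}/patch mem_set// leeDl//.
  by apply: sume_ge0 => w' _; exact: t0.
rewrite (eq_bigr (fun=> (c * 5 ^- n)%:E)); last first.
  by move=> w _; rewrite (integral_cst mu (pcell_measurable (K := K) w)) (mu_pcell hmu) size_tuple.
rewrite sumEFin lee_fin sumr_const -[leLHS]mulr_natl.
apply: (@le_trans _ _ (((2 * 274).+1 * 3 ^ n)%:R * (c * 5 ^- n))).
  apply: ler_wpM2r; first by rewrite mulr_ge0// ltW.
  by have := card_diagonal_cells R n 274; rewrite -(ler_nat R).
have scale : 3 ^+ n * 5 ^- n <= r `^ (dh - 1).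
  have -> : 3 ^+ n * 5 ^- n = (3 ^- n) `^ (dh - 1).
    rewrite powRD; last by apply/implyP => _; rewrite gt_eqF.
    by rewrite powR_scale_dim (powR_inv1 (ltW n0)) invrK mulrC.
  rewrite ge0_ler_powR ?nnegrE ?(ltW r0) ?(ltW n0)//; first by lra.
  by apply: le_trans r9; lra.
rewrite natrM natrX /c cE.
rewrite (_ : _ * _ = 12 `^ p * (2 * 274).+1%:R * ((3 ^+ n * 5 ^- n) / r `^ (dh - 1))).
  by rewrite ler_piMr ?mulr_ge0 ?powR_ge0// ler_pdivrMr ?powR_gt0// mul1r.
by field; rewrite expf_neq0//= gt_eqF// powR_gt0.
Qed.

Lemma diagonal_map_besov : besov d mu (walk_exponent p) p phi.
Proof.
split; first exact: diagonal_map_Lfun.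
have [M hM] := energy_diagonal_bounded.
apply: (@le_lt_trans _ _ M%:E); last exact: ltry.
by apply: ge_ereal_sup => _ [r /= r0 <-]; exact: hM.
Qed.

End CriticalExponentLower.

(** * The critical exponent *)

Section CriticalExponent.
Variables (R : realType) (K : vicsekSet R).
Variable d : vicsekType K -> vicsekType K -> R.
Variable mu : {measure set (vicsekBorel K) -> \bar R}.
Hypothesis hd : geodesic_distance d.
Hypothesis hmu : normalized_measure mu.
Variable p : R.
Hypothesis p1 : 1 <= p.
Let p0 : 0 < p. Proof. exact: lt_le_trans p1. Qed.

Lemma energy_ge0 (f : vicsekBorel K -> R) (alpha r : R) :
  (0 <= energy d mu p alpha f r)%E.
Proof. by apply: integral_ge0 => x _; exact: energy_integrand_ge0. Qed.

Lemma ae_constant_of_integral (f : vicsekBorel K -> R) (c : R) :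
  measurable_fun setT f -> (\int[mu]_x (`|f x - c| `^ p)%:E)%E = 0%E ->
  ae_constant mu f.
Proof.
move=> mf; rewrite (_ : (fun x => _) = fun x => `|(`|f x - c| `^ p)%:E|%E).
  have mg : measurable_fun setT (fun x => (`|f x - c| `^ p)%:E).
    exact: measurable_powR_dist.
  move=> /(proj1 (ae_eq_integral_abs mu measurableT mg)) h.
  exists c; apply: filterS h => x /(_ I) [] /eqP.
  by rewrite powR_eq0 => /andP[/eqP/normr0_eq0/eqP]; rewrite subr_eq0 => /eqP.
by apply/funext => x; rewrite abse_EFin ger0_norm// powR_ge0.
Qed.

(** A bounded energy at a larger exponent makes the energy at the walk exponent
    tend to 0 with the radius, and with it the bound of the Poincare
    inequality on the whole set. *)
Lemma besov_constant (alpha : R) (f : vicsekBorel K -> R) :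
  walk_exponent p < alpha -> besov d mu alpha p f -> ae_constant mu f.
Proof.
move=> ha [fp]; set S := ereal_sup _ => Sfin.
have ES r : 0 < r -> (energy d mu p alpha f r <= S)%E.
  by move=> r0; apply: ereal_sup_ubound; exists r.
have S0 : (0 <= S)%E by apply: le_trans (ES 1 ltr01); exact: energy_ge0.
have {Sfin} Sfin : S \is a fin_num by rewrite ge0_fin_numE.
have [D D0 hD] := poincare hd hmu p1.
pose beta := p * (alpha - walk_exponent p).
have beta0 : 0 < beta by rewrite mulr_gt0// subr_gt0.
pose c := average mu f [::]; set J := (\int[mu]_x (`|f x - c| `^ p)%:E)%E.
pose M := D * (fine S + 1).
have M0 : 0 < M by rewrite mulr_gt0// ltr_wpDl// fine_ge0.
have JM r : 0 < r -> r < 27 -> (J <= (M * r `^ beta)%:E)%E.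
  move=> r0 r27; have [n [r9 r27n]] := scale_exists r0 r27.
  have := hD f alpha r n 0%N fp r9 r27n (leq0n n).
  rewrite (bigD1 [tuple])//= pcell_nil expr0 invr1 powR1 mulr1 => h.
  apply: le_trans; first apply: le_trans h.
    by rewrite leeDl// sume_ge0// => u _; apply: integral_ge0 => x _; rewrite lee_fin powR_ge0.
  apply: (@le_trans _ _ ((D * r `^ beta)%:E * S)%E).
    by rewrite lee_wpmul2l ?ES// lee_fin mulr_ge0 ?powR_ge0// ltW.
  rewrite -{1}(fineK Sfin) -EFinM lee_fin /M mulrAC.
  by rewrite ler_wpM2r ?powR_ge0// ler_pM2l// lerDl.
apply: (@ae_constant_of_integral f c (Lfun_measurable fp)); rewrite -/J.
have J0 : (0 <= J)%E by apply: integral_ge0 => x _; rewrite lee_fin powR_ge0.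
have Jfin : J \is a fin_num.
  by rewrite ge0_fin_numE//; apply: le_lt_trans (JM 1 _ _) (ltry _) => //; rewrite ltr1n.
apply/eqP; rewrite eq_le J0 andbT leNgt -(fineK Jfin) lte_fin; apply/negP => j0.
(* a radius for which the bound is at most J / 2 *)
pose delta := fine J / (2 * M).
have delta0 : 0 < delta by rewrite divr_gt0// mulr_gt0.
pose r := Num.min 1 (delta `^ beta^-1).
have r0 : 0 < r by rewrite lt_min ltr01 powR_gt0.
have r27 : r < 27 by apply: (@le_lt_trans _ _ 1); rewrite ?ge_min ?lexx// ltr1n.
have := JM r r0 r27; rewrite -(fineK Jfin) lee_fin.
have rd : r `^ beta <= delta.
  rewrite -[leRHS]powRr1 ?(ltW delta0)// -(mulVf (lt0r_neq0 beta0)) [leRHS]powRrM.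
  by rewrite ge0_ler_powR ?nnegrE ?powR_ge0 ?(ltW r0) ?(ltW beta0)// ge_min lexx orbT.
have := ler_wpM2l (ltW M0) rd; rewrite /delta.
have -> : M * (fine J / (2 * M)) = fine J / 2 by field; rewrite gt_eqF.
by move: j0; lra.
Qed.

(** The supremum is attained, by the projection on the diagonal. *)
Lemma critical_exponentE : critical_exponent d mu p = walk_exponent p.
Proof.
set A : set R := [set alpha | 0 <= alpha /\
  exists2 f, besov d mu alpha p f & ~ ae_constant mu f].
have Aw : A (walk_exponent p).
  split; first by rewrite addr_ge0// divr_ge0 ?(ltW p0)// subr_ge0 ltW// hausdorff_dim_gt1.
  exists (@diagonal_map R K); first exact: diagonal_map_besov.
  exact: diagonal_map_nonconstant.
have Aub : ubound A (walk_exponent p).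
  move=> alpha [_ [f bf nc]]; rewrite leNgt; apply/negP => h.
  exact/nc/(besov_constant h bf).
apply/eqP; rewrite eq_le; apply/andP; split.
  by apply: ge_sup => //; exists (walk_exponent p).
by apply: ub_le_sup => //; exists (walk_exponent p).
Qed.

Lemma Var_ge0 f : (0 <= Var d mu p f)%E.
Proof.
rewrite /Var limf_einfE; apply: (@le_trans _ _ (ereal_inf
    ((fun r => energy d mu p (critical_exponent d mu p) f r `^ p^-1)%E @` setT))).
  by apply: le_ereal_inf_tmp => _ [r _ <-]; exact: poweR_ge0.
by apply: ereal_sup_ubound; exists setT => //; exact: filterT.
Qed.

(** The liminf of the energy is approached at arbitrarily small radii. *)
Lemma Var_lt (f : vicsekBorel K -> R) (v delta : R) : 0 < delta ->
  (Var d mu p f < v%:E)%E -> exists r, [/\ 0 < r, r < delta &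
    (energy d mu p (walk_exponent p) f r <= (v `^ p)%:E)%E].
Proof.
move=> delta0; rewrite /Var critical_exponentE limf_einfE => hv.
pose F r := (energy d mu p (walk_exponent p) f r `^ p^-1)%E.
have : (ereal_inf (F @` `]0%R, delta[) < v%:E)%E.
  apply: le_lt_trans hv; apply: ereal_sup_ubound; exists `]0%R, delta[%classic => //.
  apply: filterS2 (nbhs_right_gt 0) (nbhs_right_lt delta0) => r r0 rd.
  by rewrite /= in_itv /= r0.
move=> /ereal_inf_lt [_ [r rd <-] Frv]; move: rd; rewrite /= in_itv /= => /andP[r0 rd].
exists r; split => //; have E0 := energy_ge0 f (walk_exponent p) r.
move: Frv; rewrite /F; case: (energy d mu p (walk_exponent p) f r) E0 => [e||]//.
  rewrite lee_fin => e0; rewrite /poweR lte_fin => h; rewrite lee_fin.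
  rewrite -[leLHS]powRr1// -(mulVf (lt0r_neq0 p0)) [leLHS]powRrM.
  by rewrite ge0_ler_powR ?nnegrE ?powR_ge0 ?(ltW p0) ?(le_trans (powR_ge0 _ _) (ltW h))// ltW.
by rewrite /poweR invr_eq0 gt_eqF//.
Qed.

End CriticalExponent.

(** * Decomposition of the norm at a scale *)

Section Nash.
Variables (R : realType) (K : vicsekSet R).
Variable d : vicsekType K -> vicsekType K -> R.
Variable mu : {measure set (vicsekBorel K) -> \bar R}.
Hypothesis hd : geodesic_distance d.
Hypothesis hmu : normalized_measure mu.
Implicit Types (f : vicsekBorel K -> R) (p : R).

(** Written with the exponent 1 and the shift 0 so that it is an instance of
    the integrals that occur in the estimates. *)
Definition L1norm f : R := fine (\int[mu]_x (`|f x - 0| `^ 1)%:E).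

Lemma Lfun1 p f : 1 <= p -> f \in Lfun mu p%:E -> f \in Lfun mu 1%:E.
Proof.
move=> p1; apply: (@Lfun_subset _ _ _ mu 1%:E p%:E) => //.
by rewrite (mu_setT hmu).
Qed.

Lemma L1norm_fin f : f \in Lfun mu 1%:E ->
  (\int[mu]_x (`|f x - 0| `^ 1)%:E)%E = (L1norm f)%:E.
Proof.
move=> f1; rewrite /L1norm fineK//; have := integral_powR_fin hmu (lexx 1) f1 [::] 0.
by rewrite pcell_nil.
Qed.

Lemma L1norm_ge0 f : 0 <= L1norm f.
Proof. by apply: fine_ge0; apply: integral_ge0 => x _; rewrite lee_fin powR_ge0. Qed.

Lemma Lnorm1E f : f \in Lfun mu 1%:E -> 'N[mu]_1[EFin \o f]%E = (L1norm f)%:E.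
Proof.
move=> f1; rewrite Lnorm1 -L1norm_fin//; apply: eq_integral => x _.
by rewrite subr0 powRr1.
Qed.

Lemma LnormpE p f : 1 <= p -> f \in Lfun mu p%:E ->
  exists N : R, [/\ 0 <= N, 'N[mu]_(p%:E)[EFin \o f]%E = N%:E &
    (\int[mu]_x (`|f x - 0| `^ p)%:E)%E = (N `^ p)%:E].
Proof.
move=> p1 fp; have p0 : p != 0 by rewrite gt_eqF// (lt_le_trans ltr01).
have Nfin : 'N[mu]_(p%:E)[EFin \o f]%E \is a fin_num.
  rewrite ge0_fin_numE ?Lnorm_ge0//; move: fp.
  by rewrite inE => /andP[_]; rewrite inE.
exists (fine 'N[mu]_(p%:E)[EFin \o f]); split.
- by apply: fine_ge0; exact: Lnorm_ge0.
- by rewrite fineK.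
- rewrite -poweR_EFin fineK// poweR_Lnorm//; apply: eq_integral => x _.
  by rewrite subr0.
Qed.

Lemma average_le_L1 f u : f \in Lfun mu 1%:E ->
  `|average mu f u| <= 5 ^+ size u * fine (\int[mu]_(x in pcell K u) (`|f x - 0| `^ 1)%:E).
Proof.
move=> f1; have := jensen_cell hmu (lexx 1) f1 u 0.
rewrite -(fineK (integral_powR_fin hmu (lexx 1) f1 u 0)) lee_fin.
by rewrite subr0 powRr1// ler_pdivrMr ?exprn_gt0// mulrC.
Qed.

(** Bound of the L^p norm at a scale: the oscillation on the cells of level [k]
    is paid by the energy, the averages on these cells by the L^1 norm. *)
Lemma nash_at_scale p : 1 <= p -> exists2 C : R, 0 < C &
  forall f (r : R) n k, f \in Lfun mu p%:E ->
    9 * 3 ^- n <= r -> r < 27 * 3 ^- n -> (k <= n)%N ->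
  (\int[mu]_x (`|f x - 0| `^ p)%:E <=
    C%:E * (((3 ^- k) `^ (p * walk_exponent p))%:E *
      energy d mu p (walk_exponent p) f r +
      ((5 ^+ k) `^ (p - 1) * L1norm f `^ p)%:E))%E.
Proof.
move=> p1; have p0 : 0 < p by exact: lt_le_trans p1.
have [D D0 hD] := poincare hd hmu p1; have [C C0 hC] := card_near_cells_le K.
have C0' : (0 : R) < C%:R by rewrite ltr0n.
exists (2 `^ p * (D + C%:R)); first by rewrite mulr_gt0 ?powR_gt0// addr_gt0.
move=> f r n k fp r9 r27 kn; have f1 := Lfun1 p1 fp.
have mf := Lfun_measurable fp.
pose b (u : word) := fine (\int[mu]_(x in pcell K u) (`|f x - 0| `^ 1)%:E).
have bE u : (\int[mu]_(x in pcell K u) (`|f x - 0| `^ 1)%:E)%E = (b u)%:E.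
  by rewrite fineK// (integral_powR_fin hmu (lexx 1) f1).
have b0 u : 0 <= b u.
  by apply: fine_ge0; apply: integral_ge0 => x _; rewrite lee_fin powR_ge0.
set L := L1norm f; have L0 : 0 <= L := L1norm_ge0 f.
have bL u : b u <= L.
  rewrite -lee_fin -bE -L1norm_fin//; apply: ge0_subset_integral => //.
  - exact: pcell_measurable.
  - exact: measurable_powR_dist.
have bsum : \sum_(u : k.-tuple 'I_5) b u <= C%:R * L.
  rewrite -lee_fin -sumEFin EFinM /L -L1norm_fin// -[C%:R]mulr1.
  under eq_bigr do rewrite -bE.
  apply: (@integral_multiplicity _ _ _ mu _ predT (fun u : k.-tuple 'I_5 => pcell K u)
    (fun _ x => (`|f x - 0| `^ 1)%:E)) => //.
  - by move=> u; exact: pcell_measurable.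
  - by move=> u; exact: measurable_powR_dist.
  - by move=> u x _ _; rewrite mul1e.
  - by move=> x; exact: card_pcell_le.
have E0 : (0 <= energy d mu p (walk_exponent p) f r)%E by exact: energy_ge0.
set B : R := (5 ^+ k) `^ (p - 1); have B0 : 0 <= B by exact: powR_ge0.
have avg (u : k.-tuple 'I_5) :
    `|average mu f u - 0| `^ p * 5 ^- size u <= B * L `^ (p - 1) * b u.
  have := average_le_L1 u f1; rewrite -/(b u) size_tuple subr0 => h.
  have pm (x : R) : 0 <= x -> x `^ p = x `^ (p - 1) * x.
    rewrite le_eqVlt => /predU1P[<-|x0]; first by rewrite mulr0 powR0// gt_eqF.
    rewrite -[X in _ * X](powRr1 (ltW x0)) -powRD ?subrK//.
    by apply/implyP => _; rewrite gt_eqF.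
  have h5 : (0 : R) < 5 ^+ k by rewrite exprn_gt0.
  apply: (@le_trans _ _ ((5 ^+ k * b u) `^ p * 5 ^- k)).
    rewrite ler_wpM2r ?invr_ge0 ?(ltW h5)//.
    by rewrite ge0_ler_powR ?nnegrE ?(ltW p0)// mulr_ge0// ltW.
  rewrite powRM ?(ltW h5)// (pm (5 ^+ k)) ?(ltW h5)// -/B mulrAC mulfK ?gt_eqF//.
  rewrite -[leRHS]mulrA; apply: ler_wpM2l => //; rewrite (pm (b u))//.
  apply: ler_wpM2r => //.
  by rewrite ge0_ler_powR ?nnegrE ?subr_ge0.
have Lp : L `^ (p - 1) * L = L `^ p.
  have [->|LN0] := eqVneq L 0; first by rewrite mulr0 powR0// gt_eqF.
  rewrite -[X in _ * X]powRr1// -powRD ?subrK//.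
  by apply/implyP.
have cover := cell_cover_le fp [::] k 0; rewrite pcell_nil in cover.
apply: (le_trans cover).
apply: (@le_trans _ _ (\sum_(u : k.-tuple 'I_5) ((2 `^ p)%:E *
    (\int[mu]_(x in pcell K u) (`|f x - average mu f u| `^ p)%:E +
      (B * L `^ (p - 1) * b u)%:E))%E)).
  apply: lee_sum => u _; apply: (le_trans (cell_powR_shift hmu p1 fp u (average mu f u) 0)).
  by rewrite lee_wpmul2l ?lee_fin ?powR_ge0// leeD2l// lee_fin.
rewrite -ge0_sume_distrr; last first.
  move=> u _; rewrite adde_ge0//.
    by apply: integral_ge0 => x _; rewrite lee_fin powR_ge0.
  by rewrite lee_fin !mulr_ge0 ?powR_ge0.
rewrite EFinM -muleA lee_wpmul2l ?lee_fin ?powR_ge0// big_split /= sumEFin.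
rewrite ge0_muleDr ?lee_fin ?mule_ge0 ?mulr_ge0 ?lee_fin ?powR_ge0//.
apply: leeD.
  have := hD f (walk_exponent p) r n k fp r9 r27 kn.
  rewrite subrr mulr0 powRr0 mulr1 => h; apply: (le_trans h).
  rewrite muleA -EFinM lee_wpmul2r// lee_fin ler_wpM2r ?powR_ge0//.
  by rewrite lerDl ltW.
rewrite -EFinM lee_fin -mulr_sumr -Lp.
apply: (@le_trans _ _ (B * L `^ (p - 1) * (C%:R * L))).
  by rewrite ler_wpM2l// mulr_ge0 ?powR_ge0.
rewrite (_ : B * L `^ (p - 1) * (C%:R * L) = C%:R * (B * (L `^ (p - 1) * L))); last by ring.
by rewrite ler_wpM2r ?mulr_ge0 ?powR_ge0// lerDr ltW.
Qed.

End Nash.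

(** * Nash and sup norm inequalities *)

Section Inequalities.
Variables (R : realType) (K : vicsekSet R).
Variable d : vicsekType K -> vicsekType K -> R.
Variable mu : {measure set (vicsekBorel K) -> \bar R}.
Hypothesis hd : geodesic_distance d.
Hypothesis hmu : normalized_measure mu.
Implicit Types (f : vicsekBorel K -> R).

Lemma L1norm_le (p : R) f (N : R) : 1 <= p -> f \in Lfun mu p%:E -> 0 <= N ->
  (\int[mu]_x (`|f x - 0| `^ p)%:E)%E = (N `^ p)%:E -> L1norm mu f <= N.
Proof.
move=> p1 fp N0 IE; have f1 := Lfun1 hmu p1 fp; have p0 : 0 < p by exact: lt_le_trans p1.
have L0 := L1norm_ge0 mu f.
have gi : mu.-integrable setT (EFin \o (fun x => `|f x|)).
  have := Lfun_integrable (lexx 1) f1.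
  by under eq_fun do rewrite powRr1//.
have gL : (\int[mu]_x (`|f x|)%:E)%E = (L1norm mu f * 1)%:E.
  rewrite mulr1 -(L1norm_fin hmu f1); apply: eq_integral => x _.
  by rewrite subr0 powRr1.
have := jensen_average 0 measurableT (mu_setT hmu) p1 gi gL.
rewrite mulr1 subr0 ger0_norm// (_ : (\int[mu]_x _)%E = (N `^ p)%:E); last first.
  by rewrite -IE; apply: eq_integral => x _; rewrite !subr0 normr_id.
rewrite lee_fin => h; rewrite leNgt; apply/negP => NL.
by move: h; rewrite leNgt gt0_ltr_powR// nnegrE.
Qed.

(** The choice of the scale: with [q = L / W], both bounds are multiples of the
    right-hand side at the scale [rho = q `^ (p / (p - 1 + p * dh))], and a
    power of 3 just below it is good enough. *)
Lemma balance_scales (p W L : R) : 1 < p -> 0 < L -> L <= W ->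
  let dh := hausdorff_dim R in
  let theta := (p - 1) * dh / (p - 1 + p * dh) in
  exists k, (3 ^- k) `^ (p * walk_exponent p) * W `^ p <=
      (W `^ theta * L `^ (1 - theta)) `^ p /\
    (5 ^+ k) `^ (p - 1) * L `^ p <=
      5 `^ (p - 1) * (W `^ theta * L `^ (1 - theta)) `^ p.
Proof.
move=> p1 L0 LW dh theta.
have W0 : 0 < W by exact: lt_le_trans LW.
have p0 : 0 < p by lra.
have dh1 : 1 < dh := hausdorff_dim_gt1 R.
have dh0 : 0 < dh by lra.
have pm0 : 0 < p - 1 by lra.
have s0 : 0 < p - 1 + p * dh by apply: addr_gt0 => //; exact: mulr_gt0.
pose s := p - 1 + p * dh; pose q := L / W.
have q0 : 0 < q by rewrite divr_gt0.
have q1 : q <= 1 by rewrite ler_pdivrMr// mul1r.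
have LE : L = q * W by rewrite /q divfK// gt_eqF.
pose rho := q `^ (p / s).
have rho0 : 0 < rho by rewrite powR_gt0.
have rho1 : rho <= 1.
  have := @ge0_ler_powR R (p / s) _ q 1; rewrite powR1; apply => //.
  - by rewrite divr_ge0// ltW.
  - by rewrite nnegrE ltW.
  - by rewrite nnegrE.
have [k [k9 k27]] := @scale_exists R (9 * rho) ltac:(by rewrite mulr_gt0) ltac:(by lra).
have k0 : (0 : R) < 3 ^- k by rewrite invr_gt0 exprn_gt0.
have krho : 3 ^- k <= rho by lra.
have rhok : rho < 3 * 3 ^- k by lra.
have prod : (W `^ theta * L `^ (1 - theta)) `^ p = q `^ (p * (1 - theta)) * W `^ p.
  rewrite LE (powRM _ (ltW q0) (ltW W0)) mulrCA -powRD; last first.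
    by apply/implyP => _; rewrite gt_eqF.
  rewrite (_ : theta + (1 - theta) = 1) ?powRr1 ?(ltW W0)//; last by ring.
  rewrite powRM ?powR_ge0 ?(ltW W0)//.
  by rewrite -powRrM [(1 - _) * _]mulrC.
exists k; split.
  rewrite prod ler_wpM2r ?powR_ge0//.
  have -> : q `^ (p * (1 - theta)) = rho `^ (p * walk_exponent p).
    rewrite /rho -powRrM walk_exponentE ?gt_eqF// /theta -/dh -/s; congr (_ `^ _).
    by rewrite /s; field; rewrite gt_eqF.
  rewrite ge0_ler_powR ?nnegrE ?(ltW k0) ?(ltW rho0)//.
  by rewrite walk_exponentE ?gt_eqF//; rewrite addr_ge0//; [lra|exact: ltW (lt_trans ltr01 dh1)].
have h5 : 5 ^+ k <= 5 * (rho `^ dh)^-1.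
  rewrite ler_pdivlMr ?powR_gt0//.
  have -> : 5 ^+ k = ((3 ^- k) `^ dh)^-1 by rewrite powR_scale_dim invrK.
  rewrite mulrC ler_pdivrMr ?powR_gt0//.
  have <- : 3 `^ dh = 5.
    by rewrite /powR gt_eqF// /dh /hausdorff_dim divfK ?gt_eqF ?ln3_gt0// lnK// posrE.
  rewrite -powRM ?(ltW k0)// ge0_ler_powR ?nnegrE ?(ltW rho0) ?(ltW rhok)//.
    by exact: ltW (lt_trans ltr01 dh1).
apply: (@le_trans _ _ ((5 * (rho `^ dh)^-1) `^ (p - 1) * L `^ p)).
  rewrite ler_wpM2r ?powR_ge0// ge0_ler_powR ?nnegrE ?exprn_ge0//; first by lra.
  by rewrite mulr_ge0// invr_ge0 powR_ge0.
rewrite prod powRM ?invr_ge0 ?powR_ge0// -mulrA ler_wpM2l ?powR_ge0//.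
rewrite LE (powRM _ (ltW q0) (ltW W0)) mulrA ler_wpM2r ?powR_ge0//.
rewrite le_eqVlt; apply/orP; left; apply/eqP.
rewrite -powR_inv1 ?powR_ge0// /rho -!powRrM -powRD; last first.
  by apply/implyP => _; rewrite gt_eqF.
congr (_ `^ _); rewrite /theta -/dh -/s; rewrite /s; field.
by rewrite gt_eqF.
Qed.

(** By the choice of the scale [k], the oscillation on the cells of level [k]
    and their averages have the same order. The energy is read at a radius
    below this scale at which it is close to its lower limit. *)
Theorem nash_inequality (p : R) : 1 < p ->
  let dh : R := hausdorff_dim R in
  let theta : R := (p - 1) * dh / (p - 1 + p * dh) in
  exists2 C : R, 0 < C & forall f, f \in Lfun mu p%:E ->
    ('N[mu]_(p%:E)[EFin \o f] <=
       C%:E * ('N[mu]_(p%:E)[EFin \o f] + Var d mu p f) `^ theta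
            * 'N[mu]_1[EFin \o f] `^ (1 - theta))%E.
Proof.
move=> p1' dh theta; have p1 := ltW p1'; have p0 : 0 < p by lra.
have dh1 : 1 < dh := hausdorff_dim_gt1 R.
have dh0 : 0 < dh by lra.
have pm0 : 0 < p - 1 by lra.
have s0 : 0 < p - 1 + p * dh by apply: addr_gt0 => //; exact: mulr_gt0.
have theta0 : 0 < theta by rewrite divr_gt0// mulr_gt0//; lra.
have [C C0 hC] := nash_at_scale hd hmu p1.
pose c := C * (1 + 5 `^ (p - 1)).
have c0 : 0 < c by rewrite mulr_gt0// addr_gt0 ?powR_gt0.
exists (c `^ p^-1); first by rewrite powR_gt0.
move=> f fp; have f1 := Lfun1 hmu p1 fp.
have [N [N0 NE IE]] := LnormpE p1 fp.
rewrite NE (Lnorm1E hmu f1); set L := L1norm mu f.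
have L0 : 0 <= L by exact: L1norm_ge0.
have V0 := Var_ge0 d mu p f; move: (Var d mu p f) V0 (Var_lt hd hmu p1 (f := f)) => V V0 hV.
have [N00|NN0] := eqVneq N 0.
  rewrite N00 mule_ge0//; last by rewrite poweR_ge0.
  by rewrite mule_ge0// ?poweR_ge0// lee_fin powR_ge0.
have {NN0} N0' : 0 < N by rewrite lt_neqAle eq_sym NN0.
have L0' : 0 < L.
  rewrite lt_neqAle L0 andbT eq_sym; apply/eqP => LE0.
  have := Lnorm1E hmu f1; rewrite -/L LE0 => /(Lnorm_eq0_eq0 _ _).
  have mEf : measurable_fun setT (EFin \o f).
    by apply/measurable_EFinP; exact: Lfun_measurable fp.
  move=> /(_ mEf lte01) f00; have : N `^ p = 0.
    apply: EFin_inj; rewrite -IE -[RHS](integral0 mu setT).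
    apply: ae_eq_integral => //.
      by apply: measurable_powR_dist; exact: Lfun_measurable fp.
    apply: filterS f00 => x /= h _; have [->] := h I.
    by rewrite subr0 normr0 powR0// gt_eqF.
  by move=> /eqP; rewrite powR_eq0 gt_eqF.
have LN : L <= N by exact: L1norm_le p1 fp N0 IE.
move: V V0 hV => [v v0 hV|_ _|//]; last first.
  rewrite addey// /poweR (gt_eqF theta0) gt0_muley ?lte_fin ?powR_gt0//.
  by rewrite gt0_mulye ?leey// lte_fin powR_gt0.
set W := N + v; have W0 : 0 < W by rewrite ltr_wpDr// -lee_fin.
have [k [k1 k2]] := @balance_scales p W L p1' L0' ltac:(rewrite /W; move: v0; rewrite lee_fin; lra).
have [r [r0 rk rE]] := hV W (9 * 3 ^- k) ltac:(by rewrite mulr_gt0// invr_gt0 exprn_gt0)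
  ltac:(by rewrite lte_fin /W ltrDr).
have r27' : r < 27.
  apply: (lt_le_trans rk); apply: (@le_trans _ _ (9 * 1)); last by rewrite mulr1 ler_nat.
  by rewrite ler_pM2l// invf_le1 ?exprn_gt0// exprn_ege1// ler1n.
have [n [r9 r27]] := scale_exists r0 r27'.
have kn := scale_level rk r9.
have := hC f r n k fp r9 r27 kn; rewrite IE => main.
rewrite -EFinD -/W -!EFinM lee_fin -mulrA.
set X := W `^ theta * L `^ (1 - theta) in k1 k2 *.
have X0 : 0 <= X by rewrite mulr_ge0 ?powR_ge0.
have NX : N `^ p <= c * X `^ p.
  rewrite -lee_fin; apply: (le_trans main).
  apply: (@le_trans _ _ (C%:E * (X `^ p + 5 `^ (p - 1) * X `^ p)%:E)%E).
    rewrite lee_wpmul2l ?lee_fin ?(ltW C0)// EFinD leeD ?lee_fin//.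
    apply: (@le_trans _ _ (((3 ^- k) `^ (p * walk_exponent p))%:E * (W `^ p)%:E)%E).
      by rewrite lee_wpmul2l// lee_fin powR_ge0.
    by rewrite -EFinM lee_fin.
  by rewrite -EFinM lee_fin /c -mulrA [(1 + _) * _]mulrDl mul1r.
have root (x : R) : 0 <= x -> x = (x `^ p) `^ p^-1.
  by move=> x0; rewrite -powRrM mulfV ?gt_eqF// powRr1.
apply: (@le_trans _ _ ((c * X `^ p) `^ p^-1)).
  rewrite [leLHS](root N N0) ge0_ler_powR ?nnegrE ?powR_ge0 ?invr_ge0 ?(ltW p0)//.
  by rewrite mulr_ge0 ?powR_ge0// ltW.
by rewrite (powRM _ (ltW c0) (powR_ge0 X p)) -(root X X0).
Qed.

(** For p = 1 a chain of cells costs nothing, whatever its length: all averages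
    over cells of level [n] stay within a multiple of the energy from each
    other, while the total oscillation at this level is of order 5 ^- n. *)
Lemma averages_bounded : exists2 D : R, 0 < D &
  forall f (r e : R) n, f \in Lfun mu 1%:E -> 9 * 3 ^- n <= r -> r < 27 * 3 ^- n ->
    (energy d mu 1 (walk_exponent 1) f r <= e%:E)%E ->
  (forall t : n.-tuple 'I_5, `|average mu f t| <= L1norm mu f + D * e) /\
  (\sum_(t : n.-tuple 'I_5) oscillation mu 1 f n t <= D * e * 5 ^- n).
Proof.
have [D D0 hD] := total_oscillation hd hmu (lexx 1).
have walk1 : 1 * walk_exponent 1 = hausdorff_dim R.
  by rewrite walk_exponentE ?oner_eq0// subrr add0r.
exists (5 * D); first by rewrite mulr_gt0.
move=> f r e n f1 r9 r27 Ee.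
have e0 : 0 <= e by rewrite -lee_fin; apply: le_trans Ee; exact: energy_ge0.
have := hD f (walk_exponent 1) r n f1 r9 r27.
rewrite subrr mulr0 powRr0 mulr1 walk1 powR_scale_dim.
set S := \sum_(t : n.-tuple 'I_5) _ => hS.
have n50 : (0 : R) < 5 ^- n by rewrite invr_gt0 exprn_gt0.
have SE : S <= D * e * 5 ^- n.
  rewrite -lee_fin; apply: (le_trans hS); rewrite mulrAC [X in (_ <= X)%E]EFinM.
  by rewrite lee_wpmul2l// lee_fin mulr_ge0 ?(ltW D0)// ltW.
have S5 : 5 ^+ n * S <= D * e.
  by rewrite mulrC -ler_pdivlMr ?exprn_gt0.
have De0 : 0 <= D * e by rewrite mulr_ge0// ltW.
rewrite -(mulrA 5 D e); split; last first.
  by apply: (le_trans SE); apply: ler_wpM2r; [exact: ltW n50|lra].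
(* all averages are compared with the one over a corner cell *)
pose c := average mu f (nseq n ord0).
have close (t : n.-tuple 'I_5) : `|average mu f t - c| `^ 1 <= D * e.
  have := average_chain hmu (lexx 1) f1 [::] (size_tuple t).
  rewrite subrr powRr0 mul1r add0n distrC => h; exact: le_trans h S5.
have fc : (\int[mu]_(x in pcell K [::]) (`|f x - c| `^ 1)%:E <= (4 * (D * e))%:E)%E.
  apply: (le_trans (cell_integral_le hmu (lexx 1) f1 (u := [::]) (m := n) close)).
  rewrite lee_fin powRr1// add0n expr0 invr1 mulr1 -/S.
  have : S <= D * e.
    apply: (le_trans SE); by rewrite ler_piMr// invf_le1 ?exprn_gt0 ?ltr0n// exprn_ege1// ler1n.
  by lra.
have avg0 : `|average mu f [::] - c| <= 4 * (D * e).
  have := le_trans (jensen_cell hmu (lexx 1) f1 [::] c) fc.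
  by rewrite lee_fin powRr1// expr0 invr1 mulr1.
have avg1 : `|average mu f [::]| <= L1norm mu f.
  by have := average_le_L1 hmu [::] f1; rewrite pcell_nil expr0 mul1r.
move=> t; have := close t; rewrite powRr1// => ct.
have := ler_normD (average mu f t - c) (c - average mu f [::]).
have := ler_normD (average mu f t - c + (c - average mu f [::])) (average mu f [::]).
by rewrite addrA subrK subrK (distrC c); lra.
Qed.

(** The averages over cells of all levels are bounded by the same [M], and [f]
    is close to them in mean; hence the excess of [f] over [M], of which the
    integral is at most the total oscillation at any level, vanishes. *)
Theorem sup_inequality : exists2 C : R, 0 < C &
  forall f, f \in Lfun mu 1%:E ->
    ('N[mu]_(+oo)[EFin \o f] <=
       C%:E * ('N[mu]_1[EFin \o f] + Var d mu 1 f))%E.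
Proof.
have [D D0 hD] := averages_bounded.
exists (1 + D); first by rewrite addr_gt0.
move=> f f1; rewrite (Lnorm1E hmu f1); set L := L1norm mu f.
have L0 : 0 <= L by exact: L1norm_ge0.
have mf := Lfun_measurable f1.
have V0 := Var_ge0 d mu 1 f.
move: (Var d mu 1 f) V0 (Var_lt hd hmu (lexx 1) (f := f)) => [v v0 hV|_ _|//]; last first.
  by rewrite addey// gt0_muley ?leey// lte_fin addr_gt0.
rewrite lee_fin in v0; rewrite -EFinD -EFinM; apply/lee_addgt0Pr => eps eps0.
rewrite unlock /Lnorm mu_setT// lte01.
pose e := eps / D; have e0 : 0 < e by rewrite divr_gt0.
pose M := L + D * (v + e).
apply: (@le_trans _ _ M%:E); last first.
  rewrite -EFinD lee_fin /M mulrDr /e [D * (eps / D)]mulrC divfK ?gt_eqF//.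
  by rewrite mulrDl !mul1r; have := mulr_ge0 (ltW D0) L0; lra.
apply/ess_supP.
pose h x := Num.max 0 (`|f x| - M).
have h0 x : 0 <= h x by rewrite le_max lexx.
have mh : measurable_fun setT (EFin \o h).
  apply/measurable_EFinP; apply: measurable_maxr; first exact: measurable_cst.
  by apply: measurable_funB => //; exact: measurableT_comp.
have hJ : (\int[mu]_x `|(h x)%:E| = 0)%E.
  apply/eqP; rewrite eq_le integral_ge0// andbT.
  apply/lee_addgt0Pr => t t0; rewrite add0e.
  pose B := D * (v + e); have B0 : 0 < B by rewrite mulr_gt0// ltr_wpDl.
  have [r [r0 rt rE]] := hV (v + e) (Num.min 9 (t / B))
    ltac:(by rewrite lt_min ltr0n divr_gt0) ltac:(by rewrite lte_fin ltrDl).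
  move: rt; rewrite lt_min => /andP[r9' rt].
  have [n [r9 r27]] := @scale_exists R r r0 ltac:(by apply: lt_trans r9' _; rewrite ltr_nat).
  move: rE; rewrite powRr1 => [rE|]; last by rewrite addr_ge0// ltW.
  have [avg osc] := hD f r (v + e) n f1 r9 r27 rE.
  have cover := integral_cover mu (P := predT) (B := fun t : n.-tuple 'I_5 => pcell K t)
    (A := setT) (h := fun x => `|(h x)%:E|%E).
  apply: (le_trans (cover _ _ _ _)) => //.
  - by move=> u; exact: pcell_measurable.
  - exact: measurableT_comp.
  - move=> x _; have [u ux] : exists t : n.-tuple 'I_5, pcell K ([::] ++ t) x.
      by apply: pcell_cover; rewrite pcell_nil.
    by exists u.
  apply: (@le_trans _ _ (\sum_(u : n.-tuple 'I_5) (oscillation mu 1 f n u)%:E)%E).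
    apply: lee_sum => u _; apply: le_trans (oscillation_adjacent hmu (lexx 1) f1
      (size_tuple u) (adjacent_refl R u)).
    apply: ge0_le_integral_any => x _ //=.
    rewrite ger0_norm// lee_fin powRr1// /h ge_max normr_ge0 /= lerBlDr.
    have := ler_normD (f x - average mu f u) (average mu f u); rewrite subrK => h1.
    by have := avg u; rewrite -/L /M; lra.
  rewrite sumEFin lee_fin; apply: (le_trans osc); rewrite -/B.
  rewrite mulrC -ler_pdivlMr//; apply: le_trans (ltW rt).
  apply: le_trans r9; apply: (@le_trans _ _ (3 ^- n)); last first.
    by rewrite ler_peMl ?ler1n// invr_ge0 exprn_ge0.
  by rewrite lef_pV2 ?posrE ?exprn_gt0// lerXn2r ?nnegrE// ler_nat.
have := proj1 (ae_eq_integral_abs mu measurableT mh) hJ.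
apply: filterS => x /(_ I) /= [] hx; rewrite lee_fin.
by rewrite -subr_le0 -hx le_max lexx orbT.
Qed.

End Inequalities.

Theorem corollary6p5 (R : realType) (K : vicsekSet R)
    (d : vicsekType K -> vicsekType K -> R)
    (mu : {measure set (vicsekBorel K) -> \bar R})
    (hd : geodesic_distance d) (hmu : normalized_measure mu) :
  (forall p : R, 1 < p ->
     let dh : R := hausdorff_dim R in
     let theta : R := (p - 1) * dh / (p - 1 + p * dh) in
     exists C : R, 0 < C /\
       forall f : vicsekBorel K -> R,
         KS d mu (critical_exponent d mu p) p f ->
         ('N[mu]_(p%:E)[EFin \o f] <=
            C%:E * ('N[mu]_(p%:E)[EFin \o f] + Var d mu p f) `^ theta
                 * 'N[mu]_1[EFin \o f] `^ (1 - theta))%E)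
  /\
  (exists C : R, 0 < C /\
     forall f : vicsekBorel K -> R,
       KS d mu (hausdorff_dim R) 1 f ->
       ('N[mu]_(+oo)[EFin \o f] <=
          C%:E * ('N[mu]_1[EFin \o f] + Var d mu 1 f))%E).
Proof.
split; [move=> p p1 dh theta|].
  have [C C0 hC] := nash_inequality hd hmu p1.
  by exists C; split=> // f [fp _]; exact: hC.
have [C C0 hC] := sup_inequality hd hmu.
by exists C; split=> // f [f1 _]; exact: hC.
Qed.
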